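(* Let $R$ be a finite commutative ring of the form \[ (\mathbb{Z}/2\mathbb{Z})^{k_1} \times (\mathbb{Z}/4\mathbb{Z})^{k_2} \times (\mathbb{Z}/8\mathbb{Z})^{k_3} \times (\mathbb{F}_2[x]/(x^2))^{k_4} \times R', \] where $k_1,k_2,k_3,k_4$ are nonnegative integers and $R'$ is a product of local rings none of which is isomorphic to $\mathbb{Z}/2\mathbb{Z}$, $\mathbb{Z}/4\mathbb{Z}$, $\mathbb{Z}/8\mathbb{Z}$ or $\mathbb{F}_2[x]/(x^2)$. Then \[ D(U(R)) + k_1 \le D(R) \le D(U(R)) + k_1 + k_2 + k_3 + k_4. \] In addition, equality holds on the right if $|U(R)|$ is a power of $2$ or if $k_2 = k_3 = k_4 = 0$.
   Context: Rings are commutative and unital. For a commutative semigroup $S$ with identity, written multiplicatively, a finite sequence $A$ of elements of $S$ has product $\pi(A)$, the empty sequence having product $1$. The sequence $A$ is reducible if there is a proper subsequence $A' \subsetneq A$ (possibly empty) with $\pi(A') = \pi(A)$; otherwise it is irreducible. The Davenport constant $D(S)$ is the minimum positive integer $k$ such that every sequence of $k$ elements of $S$ is reducible (with $D(S)=\infty$ if no such $k$ exists). For a ring $R$, $D(R)$ denotes $D$ of the semigroup of all elements of $R$ under multiplication, and $U(R)$ is the group of units of $R$. The product of local rings $R'$ may be empty, in which case $R'$ is the zero ring. *)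

(* Defs.v *)
From HB Require Import structures.
From mathcomp Require Import all_boot all_algebra.
Set Implicit Arguments.
Unset Strict Implicit.
Unset Printing Implicit Defensive.
Import GRing.Theory.
Local Open Scope ring_scope.

Section Davenport.
Variables (S : finType) (idx : S) (op : Monoid.com_law idx).

Definition seq_prod (A : seq S) : S := \big[op/idx]_(x <- A) x.

(* A subsequence is selected by a mask m; it is proper iff m drops an index. *)
Definition reducible (A : seq S) : bool :=
  [exists m : (size A).-tuple bool,
     (false \in m) && (seq_prod (mask m A) == seq_prod A)].

Lemma reducibleP (A : seq S) :
  reflect (exists B, [/\ subseq B A, (size B < size A)%N
                       & seq_prod B = seq_prod A])
          (reducible A).
Proof.
have propE (m : bitseq) : size m = size A ->
    (size (mask m A) < size A)%N = (false \in m).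
  move=> sz_m; rewrite size_mask // -sz_m.
  by rewrite ltn_neqAle count_size andbT -all_count -has_predC -has_pred1;
     apply/eq_has; case.
apply: (iffP existsP) => [[m /andP[m0 /eqP eqm]] | [B [/subseqP[m sz_m ->]]]].
  by exists (mask m A); rewrite mask_subseq propE ?size_tuple.
rewrite propE // => m0 eqm; have sz_m' : size m == size A by apply/eqP.
by exists (Tuple sz_m'); rewrite /= m0 eqm /=.
Qed.

Definition all_reducible (k : nat) : bool :=
  (0 < k)%N && [forall A : k.-tuple S, reducible A].

(* D(S) is finite: two prefixes of a sequence of length #|S| have equal product. *)
Lemma all_reducible_exists : exists k, all_reducible k.
Proof.
exists #|S|; apply/andP; split; first by apply/card_gt0P; exists idx.
apply/forallP=> A; apply/reducibleP.
pose f (i : 'I_#|S|.+1) := seq_prod (take i A).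
have /injectivePn[i [j ne_ij eqf]] : ~~ injectiveb f.
  by apply/negP=> /injectiveP/leq_card; rewrite card_ord ltnn.
wlog lt_ij : i j ne_ij eqf / (i < j)%N => [W|].
  have: i != j :> nat by [].
  rewrite neq_ltn => /orP[] lt; first exact: W lt.
  by apply: (W j i) => //; rewrite eq_sym.
have le_jA : (j <= size A)%N by rewrite size_tuple -ltnS.
exists (take i A ++ drop j A); split.
- rewrite -[X in subseq _ X](cat_take_drop j A) cat_subseq //.
  by rewrite -(take_takel A (ltnW lt_ij)) take_subseq.
- rewrite size_cat size_drop size_take (leq_trans lt_ij le_jA).
  by rewrite -{2}(subnKC le_jA) ltn_add2r.
- rewrite -[in RHS](cat_take_drop j A) /seq_prod !big_cat.
  by congr (op _ _).
Qed.

Definition davenport : nat := ex_minn all_reducible_exists.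

End Davenport.

(* GRing.unit is only available for nonzero rings, and the zero ring is allowed
   here. *)
Section Units.
Variable R : finComPzRingType.

Definition is_unit (x : R) : bool := [exists y, x * y == 1].

Definition units := {x : R | is_unit x}.
HB.instance Definition _ := Finite.on units.

Lemma is_unit1 : is_unit 1.
Proof. by apply/existsP; exists 1; rewrite mulr1. Qed.

Lemma is_unitM (x y : R) : is_unit x -> is_unit y -> is_unit (x * y).
Proof.
move=> /existsP[x' /eqP xx'] /existsP[y' /eqP yy'].
by apply/existsP; exists (x' * y'); rewrite mulrACA xx' yy' mulr1.
Qed.

Definition unit_one : units := exist _ 1 is_unit1.
Definition unit_mul (x y : units) : units :=
  exist _ (val x * val y) (is_unitM (valP x) (valP y)).

Lemma unit_mulA : associative unit_mul.
Proof. by move=> x y z; apply: val_inj; rewrite /= mulrA. Qed.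
Lemma unit_mulC : commutative unit_mul.
Proof. by move=> x y; apply: val_inj; rewrite /= mulrC. Qed.
Lemma unit_mul1 : left_id unit_one unit_mul.
Proof. by move=> x; apply: val_inj; rewrite /= mul1r. Qed.

HB.instance Definition _ :=
  Monoid.isComLaw.Build units unit_one unit_mul unit_mulA unit_mulC unit_mul1.

End Units.

Definition davenport_ring (R : finComPzRingType) : nat :=
  davenport (@GRing.mul R : Monoid.com_law 1).

Definition davenport_units (R : finComPzRingType) : nat :=
  davenport (@unit_mul R : Monoid.com_law (unit_one R)).

Definition ring_isomorphic (R1 R2 : pzRingType) : Prop :=
  exists f : {rmorphism R1 -> R2}, bijective f.

(* idealr_closed describes the proper ideals. *)
Definition maximal_ideal (R : finComNzRingType) (I : {set R}) : Prop :=
  idealr_closed I /\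
  forall J : {set R}, idealr_closed J -> I \subset J -> J = I.

Definition local_ring (R : finComNzRingType) : Prop :=
  exists! I : {set R}, maximal_ideal I.

Section DependentProduct.
Variables (I : finType) (L : I -> pzRingType).

Definition dprod_ring := {dffun forall i : I, L i}.
HB.instance Definition _ := Choice.on dprod_ring.

Implicit Types f g : dprod_ring.
Definition dprod_zero : dprod_ring := [ffun i => 0 : L i].
Definition dprod_one : dprod_ring := [ffun i => 1 : L i].
Definition dprod_opp f : dprod_ring := [ffun i => - f i].
Definition dprod_add f g : dprod_ring := [ffun i => f i + g i].
Definition dprod_mul f g : dprod_ring := [ffun i => f i * g i].

Lemma dprod_addA : associative dprod_add.
Proof. by move=> f g h; apply/ffunP=> i; rewrite !ffunE addrA. Qed.
Lemma dprod_addC : commutative dprod_add.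
Proof. by move=> f g; apply/ffunP=> i; rewrite !ffunE addrC. Qed.
Lemma dprod_add0 : left_id dprod_zero dprod_add.
Proof. by move=> f; apply/ffunP=> i; rewrite !ffunE add0r. Qed.
Lemma dprod_addN : left_inverse dprod_zero dprod_opp dprod_add.
Proof. by move=> f; apply/ffunP=> i; rewrite !ffunE addNr. Qed.
Lemma dprod_mulA : associative dprod_mul.
Proof. by move=> f g h; apply/ffunP=> i; rewrite !ffunE mulrA. Qed.
Lemma dprod_mul1 : left_id dprod_one dprod_mul.
Proof. by move=> f; apply/ffunP=> i; rewrite !ffunE mul1r. Qed.
Lemma dprod_mulr1 : right_id dprod_one dprod_mul.
Proof. by move=> f; apply/ffunP=> i; rewrite !ffunE mulr1. Qed.
Lemma dprod_mulDl : left_distributive dprod_mul dprod_add.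
Proof. by move=> f g h; apply/ffunP=> i; rewrite !ffunE mulrDl. Qed.
Lemma dprod_mulDr : right_distributive dprod_mul dprod_add.
Proof. by move=> f g h; apply/ffunP=> i; rewrite !ffunE mulrDr. Qed.

HB.instance Definition _ := GRing.isZmodule.Build dprod_ring
  dprod_addA dprod_addC dprod_add0 dprod_addN.
HB.instance Definition _ := GRing.Zmodule_isPzRing.Build dprod_ring
  dprod_mulA dprod_mul1 dprod_mulr1 dprod_mulDl dprod_mulDr.

End DependentProduct.

(* {poly %/ p} falls back to the quotient by 'X unless p is monic of positive
   degree, which 'X^2 is. *)
Definition F2_dual : comNzRingType := {poly %/ ('X^2 : {poly 'F_2})}.

(* Main.v *)
Require Import Defs.
From HB Require Import structures.
From Stdlib Require Import Classical_Prop.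
From mathcomp Require Import all_boot all_algebra all_fingroup all_solvable.
From mathcomp Require Import ring.
Set Implicit Arguments.
Unset Strict Implicit.
Unset Printing Implicit Defensive.
Import GRing.Theory.
Local Open Scope ring_scope.

(** An irreducible sequence of units is one without a nonempty subsequence of
    product 1, so D(U(R)) - 1 is the largest length of such a sequence.
    Everything is a comparison between irreducible sequences of R and sequences
    of units of this kind, done one local factor at a time.

    Upper bound.  Let A be irreducible in R, and let B be a minimal subsequence
    of A whose product P generates the same ideal as the product of A.  Each
    element of A outside B multiplies P in the same way as a unit does, so it
    can be replaced by that unit ([associate_unit]).  Each element of B is
    needed in some local factor L: without it the product no longer generates
    the ideal of the component of P in L.  If t elements of B are needed in L,
    they are replaced by t units of L that fix P ([chain_stabilizers]), or by
    t - 1 units in bad cases.  The units obtained have no nonempty subproduct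
    equal to 1: a product that involves some units of the first kind and is
    equal to 1 would let the corresponding elements of A be dropped.  Hence
    D(R) - D(U(R)) is at most the number of factors L where a unit may be lost
    ([irreducible_size_leq]).

    A unit is lost in L only if P is 0 there.  A chain of ideals also produces
    t - 1 units, and any unit u such that u - 1 is outside its first ideal prolongs it;
    so if t units cannot be found, then the maximal ideal of L is generated by
    one element x, the residue field is F_2, and t is the nilpotency index of x
    ([long_or_uniformizer]).  If some 1 + x^k squares to 1 + x^(k+1) w with w
    invertible and x^(k+1) nonzero, then t units can be found after all
    ([uniformizer_long_sequence]), and otherwise L is one of Z/2, Z/4, Z/8 and
    F_2[x]/(x^2) ([uniformizer_dichotomy]).

    Lower bound.  In each of these four rings the maximal ideal is generated by
    some x with x^r = 0 and x^(r-1) nonzero, where r is 1, 2, 3 and 2.  The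
    sequence formed of r copies of x in each of a set of such factors, and of
    units that are 1 in all these factors, is irreducible as soon as the units
    have no nonempty subproduct equal to 1 ([irreducible_powers]).  With the
    factors Z/2 alone, whose only unit is 1, this gives D(U(R)) + k1.

    When U(R) is a 2-group, let H be the group of units that are 1 in all the
    exceptional factors.  The group U(R) is generated by H and the involutions
    1 + x^j with 0 < j < r in these factors.  The augmentation ideal of the
    group algebra F_2[U(R)] bounds D(U(R)) - 1 by the sum of the orders minus
    one of any generators ([zfree_leq]), and for H a basis reaches this bound
    ([basis_zfree]).  So trading the r - 1 involutions of a factor for r copies
    of x gains one element for each exceptional factor
    ([davenport_ring_two_group]). *)

(** * Sequences without a subproduct equal to 1 *)

Lemma subseq_catE (T : eqType) (B A1 A2 : seq T) :
  subseq B (A1 ++ A2) ->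
  exists B1 B2, [/\ B = B1 ++ B2, subseq B1 A1 & subseq B2 A2].
Proof.
case/subseqP=> m; rewrite size_cat => sz_m ->.
have sz1 : size (take (size A1) m) = size A1.
  by rewrite size_takel // sz_m leq_addr.
exists (mask (take (size A1) m) A1), (mask (drop (size A1) m) A2).
by rewrite -mask_cat // cat_take_drop !mask_subseq.
Qed.

Lemma subseq_nseqE (T : eqType) (x : T) n B :
  subseq B (nseq n x) -> exists2 c, (c <= n)%N & B = nseq c x.
Proof.
move=> sub; exists (size B); first by rewrite -(size_nseq n x) size_subseq.
by apply/all_pred1P/allP=> y /(mem_subseq sub)/nseqP[-> _] /=.
Qed.

Lemma subseq_mapE (S T : eqType) (f : S -> T) A B :
  subseq B (map f A) -> exists2 A', subseq A' A & B = map f A'.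
Proof.
case/subseqP=> m _ ->; exists (mask m A); first exact: mask_subseq.
by rewrite map_mask.
Qed.

Lemma subseq_complement (T : eqType) (idx : T) (op : Monoid.com_law idx) B A :
  subseq B A ->
  exists C, [/\ subseq C A, (size B + size C = size A)%N
    & op (\big[op/idx]_(x <- B) x) (\big[op/idx]_(x <- C) x)
      = \big[op/idx]_(x <- A) x].
Proof.
elim: A B => [|a A IH] B.
  by rewrite subseq0 => /eqP->; exists [::]; rewrite !big_nil !Monoid.mulm1.
case: B => [_|b B].
  by exists (a :: A); rewrite subseq_refl big_nil !Monoid.mul1m.
rewrite /=; case: eqP => [<-|_] /IH[C [subC szC prC]].
  exists C; split; last by rewrite !big_cons -(Monoid.mulmA op); congr (op _ _).
    exact: subseq_trans subC (subseq_cons _ _).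
  by rewrite addSn szC.
exists (a :: C); split; first by rewrite /= eqxx.
  by rewrite /= addnS -szC.
by rewrite ![\big[op/idx]_(x <- a :: _) _]big_cons (Monoid.mulmCA op);
   congr (op _ _).
Qed.

Section ZeroSumFree.
Variables (T : eqType) (idx : T) (op : Monoid.law idx).
Implicit Types A B : seq T.

(** In additive notation these are the zero-sum free sequences. *)
Definition zfree A : Prop :=
  forall B, subseq B A -> \big[op/idx]_(x <- B) x = idx -> B = [::].

Lemma zfree_nil : zfree [::].
Proof. by move=> B; rewrite subseq0 => /eqP. Qed.

Lemma zfree_subseq A B : subseq B A -> zfree A -> zfree B.
Proof. by move=> sBA zA C sCB; apply: zA; apply: subseq_trans sBA. Qed.

(** The predicate K plays the part of a submonoid that contains B: it suffices
    that A has no nonempty subproduct equal to 1 modulo K.  All the sequences of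
    units below are put together in this way. *)
Lemma zfree_cat (K : T -> Prop) A B :
  K idx -> (forall x y, K x -> K y -> K (op x y)) ->
  {in B, forall x, K x} -> zfree B ->
  (forall A' k, subseq A' A -> K k ->
     op (\big[op/idx]_(x <- A') x) k = idx -> A' = [::]) ->
  zfree (A ++ B).
Proof.
move=> K1 KM KB zB zA C /subseq_catE[A' [B' [-> sA sB]]].
rewrite big_cat => /= E; have A'0 : A' = [::].
  apply: zA sA _ E; rewrite big_seq; apply: big_ind => // x xB.
  by apply: KB; apply: mem_subseq xB.
by move: E; rewrite A'0 big_nil Monoid.mul1m; apply: zB.
Qed.

Lemma zfree_cons (K : T -> Prop) g B :
  K idx -> (forall x y, K x -> K y -> K (op x y)) ->
  {in B, forall x, K x} -> zfree B ->
  (forall k, K k -> op g k <> idx) -> zfree (g :: B).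
Proof.
move=> K1 KM KB zB gK; rewrite -cat1s; apply: (zfree_cat K1) => // A' k.
rewrite (_ : [:: g] = nseq 1 g) // => /subseq_nseqE[[|[|]] // _ -> Kk].
by rewrite /= big_cons big_nil Monoid.mulm1 => /(gK k Kk).
Qed.

End ZeroSumFree.

(** * Irreducible sequences and the Davenport constant *)

Section Davenport.
Variables (S : finType) (idx : S) (op : Monoid.com_law idx).
Local Notation D := (davenport op).

Lemma reducible_cat A B : reducible op A -> reducible op (A ++ B).
Proof.
case/reducibleP=> A' [sA szA prA]; apply/reducibleP; exists (A' ++ B).
rewrite cat_subseq // !size_cat ltn_add2r; split=> //.
by move: prA; rewrite /seq_prod !big_cat /= => ->.
Qed.

(** A sequence of length at least D has a prefix of length D, and reducibility
    passes from a prefix to the whole sequence. *)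
Lemma irreducible_ltn A : ~~ reducible op A -> (size A < D)%N.
Proof.
move=> irrA; rewrite ltnNge; apply/negP=> leDA; case/negP: irrA.
rewrite -[A](cat_take_drop D); apply: reducible_cat.
move: (take D A) (size_takel leDA); rewrite /davenport.
case: ex_minnP => k /andP[_ /forallP redk] _ A' /eqP szA'.
exact: redk (Tuple szA').
Qed.

Lemma irreducible_max : exists2 A, ~~ reducible op A & (size A).+1 = D.
Proof.
have nil_irr : ~~ reducible op [::].
  by apply/negP=> /reducibleP[B []]; rewrite ltn0.
rewrite /davenport; case: ex_minnP => -[|[|k]] /andP[// _ _] minD.
  by exists [::].
have: ~~ all_reducible op k.+1 by apply/negP=> /minD; rewrite ltnn.
rewrite /all_reducible /= negb_forall => /existsP[A irrA].
by exists A; rewrite ?size_tuple.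
Qed.

Lemma irreducibleP A :
  (forall B, subseq B A -> seq_prod op B = seq_prod op A -> size B = size A) ->
  ~~ reducible op A.
Proof.
by move=> irrA; apply/negP=> /reducibleP[B [sBA lt /(irrA B sBA)eq]];
   rewrite eq ltnn in lt.
Qed.

Lemma irreducible_size A B : ~~ reducible op A -> subseq B A ->
  seq_prod op B = seq_prod op A -> size B = size A.
Proof.
move=> irrA sBA eqp; apply/eqP; rewrite eqn_leq size_subseq //= leqNgt.
by apply: contra irrA => lt; apply/reducibleP; exists B.
Qed.

End Davenport.

(** * Sequences of units *)

Section UnitSequences.
Variable R : finComPzRingType.

Lemma val_unit_prod (A : seq (units R)) :
  val (\big[@unit_mul R/unit_one R]_(u <- A) u) = \prod_(u <- A) val u.
Proof. by elim: A => [|u A IH]; rewrite ?big_nil ?big_cons //= IH. Qed.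

(** In a group, dropping a subsequence keeps the product exactly when the dropped
    elements have product 1. *)
Lemma zfree_unitsE (A : seq (units R)) :
  zfree *%R (map val A) <-> ~~ reducible (@unit_mul R) A.
Proof.
split=> [zA|irrA].
  apply: irreducibleP => B sBA eqp.
  have [C [sCA szC prC]] := subseq_complement (@unit_mul R) sBA.
  suff /(congr1 size): map val C = [::].
    by rewrite size_map -szC => ->; rewrite addn0.
  apply: zA; first exact: map_subseq.
  rewrite big_map -val_unit_prod.
  have [w /eqP vw] := existsP (valP (seq_prod (@unit_mul R) B)).
  rewrite -[LHS]mul1r -vw mulrAC.
  by move/(congr1 val): prC; rewrite /= -/(seq_prod _ A) -eqp => ->.
move=> B' /subseq_mapE[B sBA ->] pr1.
have [C [sCA szC prC]] := subseq_complement (@unit_mul R) sBA.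
have: size C = size A.
  apply: irreducible_size irrA sCA _; rewrite /seq_prod -prC.
  rewrite [X in _ = _ X _](_ : _ = unit_one R) ?Monoid.mul1m //.
  by apply: val_inj; rewrite val_unit_prod -(big_map val xpredT id).
by move/eqP; rewrite -szC -[X in X == _]add0n eqn_add2r => /eqP/esym/size0nil->.
Qed.

Lemma zfree_units_ltn (A : seq R) : all (@is_unit R) A -> zfree *%R A ->
  (size A < davenport_units R)%N.
Proof.
move=> uA zA; have eA : map val (pmap insub A : seq (units R)) = A.
  rewrite (pmap_filter (insubK _)); apply/all_filterP.
  by rewrite (eq_all (isSome_insub _)).
rewrite -eA size_map; apply: irreducible_ltn.
by apply/zfree_unitsE; rewrite eA.
Qed.

Lemma zfree_units_max : exists A : seq R,
  [/\ all (@is_unit R) A, zfree *%R A & (size A).+1 = davenport_units R].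
Proof.
have [A /zfree_unitsE zA szA] := irreducible_max (@unit_mul R).
exists (map val A); rewrite size_map; split=> //.
by apply/allP=> _ /mapP[u _ ->]; apply: valP.
Qed.

End UnitSequences.

(** * The group algebra of a 2-group over F_2 *)

Fixpoint spanned (gT : finGroupType) (gs : seq gT) (g : gT) : Prop :=
  if gs is x :: gs' then exists a h, spanned gs' h /\ g = (x ^+ a * h)%g
  else g = 1%g.

Section GroupAlgebra.
Variables (gT : finGroupType) (gC : @commutative gT gT mulg).

(** The vacuous mention of [gC] makes commutativity a parameter of the type, so
    that the commutative ring structure below can be inferred from it. *)
Definition galg := let _ := gC in {ffun gT -> 'F_2}.
HB.instance Definition _ := GRing.Zmodule.on galg.
Implicit Types (f h k : galg) (g x : gT).

Definition gmul f h : galg := [ffun z => \sum_x f x * h (x^-1 * z)%g].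
Definition gelt g : galg := [ffun z => (z == g)%:R].

Lemma gmulA : associative gmul.
Proof.
move=> f h k; apply/ffunP=> z; rewrite !ffunE.
under [RHS]eq_bigr => y _ do rewrite ffunE big_distrl /=.
rewrite exchange_big /=; apply: eq_bigr => x _.
rewrite ffunE big_distrr /= (reindex_inj (mulgI x^-1%g)) /=.
by apply: eq_bigr => y _; rewrite mulrA invMg invgK mulgA mulgK.
Qed.

Lemma gmulC : commutative gmul.
Proof.
move=> f h; apply/ffunP=> z; rewrite !ffunE.
rewrite (reindex_inj (mulgI z)) (reindex_inj invg_inj) /=.
apply: eq_bigr => x _.
by rewrite mulrC invMg invgK -mulgA mulVg mulg1 gC.
Qed.

Lemma gelt1_mul : left_id (gelt 1%g) gmul.
Proof.
move=> f; apply/ffunP=> z; rewrite ffunE (bigD1 1%g) //= ffunE eqxx mul1r.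
rewrite invg1 mul1g big1 ?addr0 // => x /negbTE nx1.
by rewrite ffunE nx1 mul0r.
Qed.

Lemma gmulDl : left_distributive gmul +%R.
Proof.
move=> f h k; apply/ffunP=> z; rewrite !ffunE -big_split.
by apply: eq_bigr => x _; rewrite ffunE mulrDl.
Qed.

HB.instance Definition _ := GRing.Zmodule_isComPzRing.Build galg
  gmulA gmulC gelt1_mul gmulDl.

Lemma galgD f h z : (f + h : galg) z = f z + h z.
Proof. by rewrite ffunE. Qed.

Lemma gelt1 : gelt 1%g = 1. Proof. by []. Qed.

Lemma gelt_mulE g f z : (gelt g * f) z = f (g^-1 * z)%g.
Proof.
rewrite ffunE (bigD1 g) //= ffunE eqxx mul1r big1 ?addr0 // => x /negbTE nxg.
by rewrite ffunE nxg mul0r.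
Qed.

Lemma geltM x y : gelt (x * y)%g = gelt x * gelt y.
Proof.
by apply/ffunP=> z; rewrite gelt_mulE !ffunE -[in RHS](inj_eq (mulgI x)) mulKVg.
Qed.

Lemma galg_double f : f + f = 0.
Proof.
by apply/ffunP=> z; rewrite !ffunE; case: (f z) => -[|[|]] // i; apply/val_inj.
Qed.

Lemma geltX x n : gelt (x ^+ n)%g = gelt x ^+ n.
Proof. by elim: n => // n IH; rewrite expgS exprS geltM IH. Qed.

(** In characteristic 2 raising to the power 2^e is additive. *)
Lemma aug_order x e : #[x]%g = (2 ^ e)%N -> (1 + gelt x) ^+ (2 ^ e) = 0.
Proof.
move=> ox; suff ->: (1 + gelt x) ^+ (2 ^ e) = 1 + gelt x ^+ (2 ^ e).
  by rewrite -geltX -ox expg_order gelt1 galg_double.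
elim: e {ox} => // e IH; rewrite expnSr !exprM IH expr2 mulrDl !mulrDr.
by rewrite !mul1r mulr1 addrACA addrA -[1 + _ + _]addrA galg_double addr0 expr2.
Qed.

(** Every factor 1 + g lies in the ideal generated by the 1 + x for x in [gs], and
    (1 + x)^n = 0 where n is the order of x; the pigeonhole principle concludes. *)
Lemma aug_prod0 (gs A : seq gT) :
  {in gs, forall x, exists e, #[x]%g = (2 ^ e)%N} ->
  {in A, forall g, spanned gs g} ->
  (\sum_(x <- gs) (#[x]%g).-1 < size A)%N ->
  \prod_(g <- A) (1 + gelt g) = 0.
Proof.
elim: gs A => [|x gs IH] A gs2 spA.
  case: A spA => [|g A] spA; first by rewrite big_nil.
  by rewrite big_cons (spA g (mem_head _ _)) gelt1 galg_double mul0r.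
have [e ox] := gs2 x (mem_head _ _).
have {}IH := IH _ (fun y yg => gs2 y (@mem_behead _ (x :: gs) y yg)).
pose s := (\sum_(y <- gs) (#[y]%g).-1)%N.
rewrite big_cons -/s.
(* The induction on A moves each factor 1 + g either to the part A', spanned by
   the other generators, or to the power of 1 + x. *)
suff kill A' (k : nat) : {in A', forall g, spanned gs g} ->
    (#[x]%g.-1 + s < size A + size A' + k)%N ->
    (1 + gelt x) ^+ k * \prod_(g <- A') (1 + gelt g)
      * \prod_(g <- A) (1 + gelt g) = 0.
  move=> lt; have := kill [::] 0%N.
  by rewrite expr0 big_nil !mul1r !addn0; apply.
elim: A spA A' k => [_|g A IHA spA] A' k spA' lt.
  rewrite big_nil mulr1; case: (leqP #[x]%g k) => [le|lt'].
    by rewrite -(subnK le) exprD ox aug_order // mulr0 mul0r.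
  rewrite IH ?mulr0 // -/s -(ltn_add2l (#[x]%g.-1)); apply: leq_trans lt _.
  by rewrite add0n addnC leq_add2r -ltnS prednK.
have {}IHA := IHA (fun y yg => spA y (@mem_behead _ (g :: A) y yg)).
have [a [h [sph eg]]] := spA g (mem_head _ _).
rewrite big_cons {}eg; elim: a => [|a IHa].
  have := IHA (h :: A') k; rewrite expg0 mul1g big_cons => <-; first by ring.
    by move=> y; rewrite inE => /predU1P[->|/spA'].
  by rewrite /= addnS -addSn.
rewrite expgS -mulgA geltM.
have ->: 1 + gelt x * gelt (x ^+ a * h)%g =
  (1 + gelt (x ^+ a * h)%g) + gelt (x ^+ a * h)%g * (1 + gelt x).
  by rewrite mulrDr mulr1 addrA -[1 + _ + _]addrA galg_double addr0 mulrC.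
rewrite mulrDl mulrDr IHa add0r.
rewrite -[RHS](mulr0 (gelt (x ^+ a * h)%g)).
by rewrite -(IHA A' k.+1) ?addnS -?addSn // exprS; ring.
Qed.

(** The product expands into the sum of the products of all the subsequences. *)
Lemma prod_gelt_support (A : seq gT) z :
  (\prod_(g <- A) (1 + gelt g) : galg) z != 0 ->
  exists2 B, subseq B A & (\prod_(b <- B) b)%g = z.
Proof.
elim: A z => [|g A IH] z.
  rewrite big_nil ffunE; case: (eqVneq z 1%g) => [-> _|_]; last by rewrite eqxx.
  by exists [::]; rewrite ?big_nil.
rewrite big_cons mulrDl mul1r galgD gelt_mulE.
have [Fz0|/IH[B sB prB] _] := eqVneq ((\prod_(g <- A) (1 + gelt g) : galg) z) 0.
  rewrite Fz0 add0r => /IH[B sB prB]; exists (g :: B); rewrite /= ?eqxx //.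
  by rewrite big_cons prB mulKVg.
by exists B => //; apply: subseq_trans (subseq_cons _ _).
Qed.

Lemma zfree_prod_gelt (A : seq gT) :
  zfree mulg A -> (\prod_(g <- A) (1 + gelt g) : galg) 1%g = 1.
Proof.
elim: A => [|g A IH] zA; first by rewrite big_nil ffunE eqxx.
rewrite big_cons mulrDl mul1r galgD gelt_mulE IH; last first.
  by apply: zfree_subseq zA; apply: subseq_cons.
rewrite mulg1.
have [->|/prod_gelt_support[B sB prB]] :=
  eqVneq ((\prod_(b <- A) (1 + gelt b) : galg) g^-1%g) 0; first by rewrite addr0.
have //: g :: B = [::].
by apply: zA; rewrite /= ?eqxx // big_cons prB mulgV.
Qed.

(** This is Olson's upper bound for the Davenport constant of a 2-group, in terms
    of generators that may satisfy relations. *)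
Lemma zfree_leq (gs A : seq gT) :
  {in gs, forall x, exists e, #[x]%g = (2 ^ e)%N} ->
  {in A, forall g, spanned gs g} -> zfree mulg A ->
  (size A <= \sum_(x <- gs) (#[x]%g).-1)%N.
Proof.
move=> gs2 spA /zfree_prod_gelt nz; rewrite leqNgt; apply/negP=> lt.
by move: nz; rewrite (aug_prod0 gs2 spA lt) ffunE => /eqP; rewrite eq_sym oner_eq0.
Qed.

End GroupAlgebra.

(** A basis (x_i) of G gives the sequence of length sum (o(x_i) - 1) in which x_i
    is repeated o(x_i) - 1 times. *)
Lemma basis_zfree (gT : finGroupType) (G : {group gT}) : abelian G ->
  exists gs : seq gT, [/\ {subset gs <= G}, forall g, g \in G -> spanned gs g
    & exists A, [/\ {subset A <= G}, zfree mulg A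
                  & size A = (\sum_(x <- gs) (#[x]%g).-1)%N]].
Proof.
case/abelian_structure => gs defG _; exists gs.
elim: gs G defG => [|x gs IH] G.
  rewrite !big_nil => defG; split=> [y|g|]; first by rewrite in_nil.
    by rewrite -defG => /set1gP.
  by exists [::]; split=> //; apply: zfree_nil.
rewrite !big_cons => defG; have [[_ H _ defH] _ _ tiXH] := dprodP defG.
rewrite defH in defG tiXH; have [sgsH spH [A [sAH zA szA]]] := IH H defH.
have defXH := dprodW defG.
have [sxG sHG] := mulG_sub defXH.
split=> [y|g|].
- by rewrite inE => /predU1P[->|/sgsH/(subsetP sHG)//]; rewrite -cycle_subG.
- rewrite -defXH => /mulsgP[y h /cycleP[a ->] /spH sph ->].
  by exists a, h.
exists (nseq (#[x]%g).-1 x ++ A); split.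
- move=> y; rewrite mem_cat => /orP[/nseqP[-> _]|/sAH/(subsetP sHG)//].
  by rewrite -cycle_subG.
- apply: (zfree_cat (K := fun y => y \in H)) => //; first exact: groupM.
  move=> A' k /subseq_nseqE[c le_c ->] Hk; rewrite big_nseq => E.
  have xc : (x ^+ c)%g \in <[x]>%g :&: H.
    rewrite inE mem_cycle -(groupMr _ Hk).
    by move: E => /=; rewrite iter_mulg_1 => ->.
  move: xc; rewrite tiXH inE -order_dvdn => dv; rewrite (_ : c = 0%N) //.
  apply/eqP; rewrite -leqn0 leqNgt; apply/negP=> /dvdn_leq/(_ dv).
  by rewrite leqNgt -(prednK (order_gt0 x)) ltnS le_c.
by rewrite size_cat size_nseq szA.
Qed.

(** * Finite local rings *)

Definition invertible (L : pzRingType) (x : L) := exists y, x * y = 1.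
Definition nilpotent_elt (L : pzRingType) (x : L) := exists n, x ^+ n = 0.
Definition unit_or_nilpotent (L : pzRingType) :=
  forall x : L, invertible x \/ nilpotent_elt x.

(** A non-unit b lies in the maximal ideal M.  Two powers of b agree, say
    b^i (1 - b^m) = 0 with m > 0, and 1 - b^m is a unit since it is outside M. *)
Lemma local_unit_or_nilpotent (L : finComNzRingType) :
  local_ring L -> unit_or_nilpotent L.
Proof.
case=> M [[idM maxM] uniqM] b; pose ideal (S : {set L}) :=
  [&& 0 \in S, 1 \notin S &
    [forall a, forall u in S, forall v in S, a * u + v \in S]].
have idealP (S : {set L}) : reflect (idealr_closed S) (ideal S).
  apply: (iffP and3P) => -[S0 S1 SD]; split=> //.
    move=> a u v uS vS.
    by move/forallP/(_ a)/forall_inP/(_ u uS)/forall_inP: SD; apply.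
  by apply/forallP=> a; apply/forall_inP=> u uS; apply/forall_inP=> v; apply: SD.
have inM c : ~ invertible c -> c \in M.
  move=> cU; pose S := [set x | [exists y, x == c * y]].
  have idS : ideal S.
    apply/idealP; split.
    - by rewrite inE; apply/existsP; exists 0; rewrite mulr0.
    - by rewrite inE; apply/existsP=> -[y /eqP E]; case: cU; exists y.
    move=> a u v; rewrite !inE => /existsP[y /eqP->] /existsP[z /eqP->].
    by apply/existsP; exists (a * y + z); apply/eqP; rewrite mulrDr mulrCA.
  have [T /maxsetP[/idealP idT maxT] sST] := maxset_exists idS.
  rewrite (uniqM T); last first.
    by split=> // J /idealP idJ sTJ; apply: maxT.
  by apply: (subsetP sST); rewrite inE; apply/existsP; exists 1; rewrite mulr1.
have [bU|/inM bM] := classic (invertible b); [by left | right].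
pose f (i : 'I_#|L|.+1) := b ^+ i.
have /injectivePn[i [j ne_ij eqf]] : ~~ injectiveb f.
  by apply/negP=> /injectiveP/leq_card; rewrite card_ord ltnn.
wlog lt_ij : i j ne_ij eqf / (i < j)%N => [W|].
  have: i != j :> nat by [].
  rewrite neq_ltn => /orP[] lt; first exact: W lt.
  by apply: (W j i) => //; rewrite eq_sym.
have [[w Ew]|/inM nM] := classic (invertible (1 - b ^+ (j - i))).
  exists i; rewrite -[LHS]mulr1 -Ew mulrA mulrBr mulr1 -exprD subnKC 1?ltnW //.
  by rewrite -[b ^+ i]/(f i) eqf subrr mul0r.
have [M0 /negP M1 MD] := idM; case: M1.
have -> : 1 = b ^+ (j - i).-1 * b + (1 - b ^+ (j - i)).
  by rewrite -exprSr prednK ?subn_gt0 // addrC subrK.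
exact: MD.
Qed.

(** * Units from chains of annihilators and of ideals *)

Section Chains.
Variable L : comNzRingType.
Implicit Types (x y q : L) (xs Z : seq L).

Lemma nilpotentM x y : nilpotent_elt x -> nilpotent_elt (x * y).
Proof. by case=> n xn; exists n; rewrite exprMn xn mul0r. Qed.

Lemma nilpotent_invertible x : nilpotent_elt x -> invertible (1 + x).
Proof.
case=> n xn; exists (\sum_(i < n) (- x) ^+ i).
have := subrX1 (- x) n; rewrite exprNn xn mulr0 sub0r => /eqP.
by rewrite -opprD mulNr eqr_opp addrC => /eqP.
Qed.

(** This replaces Nakayama's lemma: it makes chains of principal ideals
    strict. *)
Lemma nilpotent_absorb q x : nilpotent_elt x -> q = q * x -> q = 0.
Proof.
case=> n xn qx; have {qx}qX m : q = q * x ^+ m.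
  by elim: m => [|m IH]; rewrite ?mulr1 // exprS mulrA -qx.
by rewrite (qX n) xn mulr0.
Qed.

Lemma nilpotent_not_invertible x : nilpotent_elt x -> ~ invertible x.
Proof.
move=> nx [y xy]; have /eqP : 1 = 0 :> L; last by rewrite oner_eq0.
by apply: (nilpotent_absorb (nilpotentM y nx)); rewrite xy mulr1.
Qed.

(** The stabilizers of the partial products form a strictly increasing chain: if
    Q and x Q are nonzero and k is the last exponent with x^k Q nonzero, then
    1 + x^k fixes x Q but not Q. *)
Lemma chain_stabilizers y xs : {in xs, forall x, nilpotent_elt x} ->
  y * \prod_(x <- xs) x != 0 ->
  exists Z, [/\ size Z = size xs, {in Z, forall z, invertible z}, zfree *%R Z
    & {in Z, forall z, z * (y * \prod_(x <- xs) x) = y * \prod_(x <- xs) x}].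
Proof.
elim: xs => [|x xs IH] nxs; first by exists [::]; split=> //; apply: zfree_nil.
rewrite big_cons mulrCA; set Q := y * _ => xQ0.
have Q0 : Q != 0 by apply: contraNneq xQ0 => ->; rewrite mulr0.
have [|// |Z [szZ uZ zZ fixZ]] := IH.
  by move=> z zxs; apply: nxs; rewrite inE zxs orbT.
have nx := nxs x (mem_head _ _).
have exk : exists k, x ^+ k * Q == 0.
  by case: nx => n xn; exists n; rewrite xn mul0r.
case: (ex_minnP exk) => -[|[|k]] /eqP xkQ mink.
- by rewrite mul1r in xkQ; rewrite xkQ eqxx in Q0.
- by rewrite xkQ eqxx in xQ0.
have x1kQ : x ^+ k.+1 * Q != 0 by apply/negP=> /mink; rewrite ltnn.
have kil : x ^+ k.+1 * (x * Q) = 0 by rewrite mulrA -exprSr.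
exists ((1 + x ^+ k.+1) :: Z); split.
- by rewrite /= szZ.
- move=> z; rewrite inE => /predU1P[->|/uZ//].
  by apply: nilpotent_invertible; rewrite exprS; apply: nilpotentM.
- apply: (zfree_cons (K := fun k => k * Q = Q)) => //.
  + exact: mul1r.
  + by move=> a b aQ bQ; rewrite -mulrA bQ.
  move=> a aQ ga; case/eqP: x1kQ.
  have : (1 + x ^+ k.+1) * a * Q = Q by rewrite ga mul1r.
  by rewrite -mulrA aQ mulrDl mul1r => /eqP; rewrite -subr_eq0 addrC addKr => /eqP.
move=> z; rewrite inE => /predU1P[->|/fixZ zQ]; last by rewrite mulrCA zQ.
by rewrite mulrDl mul1r kil addr0.
Qed.

Definition one_mod q : L -> Prop := fun z => exists c, z = 1 + q * c.

Lemma one_mod1 q : one_mod q 1.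
Proof. by exists 0; rewrite mulr0 addr0. Qed.

Lemma one_modM q z w : one_mod q z -> one_mod q w -> one_mod q (z * w).
Proof. by case=> c -> [d ->]; exists (c + d + q * c * d); ring. Qed.

Lemma one_modW q r z : one_mod (q * r) z -> one_mod q z.
Proof. by case=> c ->; exists (r * c); rewrite mulrA. Qed.

Lemma zfree_cons_mod q g Z :
  {in Z, forall z, one_mod q z} -> zfree *%R Z -> ~ one_mod q g ->
  zfree *%R (g :: Z).
Proof.
move=> modZ zZ ng; apply: (zfree_cons (K := one_mod q)) => //.
- exact: one_mod1.
- exact: one_modM.
move=> _ [c ->] E; case: ng; exists (- (g * c)).
by move: E => /= E; rewrite -[X in X + _]E; ring.
Qed.

(** For nilpotent factors, the ideals generated by the partial products of q and
    xs decrease strictly, hence so do the subgroups 1 + I for I in this chain. *)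
Lemma chain_ideals q xs : nilpotent_elt q ->
  {in xs, forall x, nilpotent_elt x} -> q * \prod_(x <- xs) x != 0 ->
  exists Z, [/\ size Z = (size xs).+1, {in Z, forall z, invertible z},
    zfree *%R Z & {in Z, forall z, one_mod q z}].
Proof.
elim: xs q => [|x xs IH] q nq nxs.
  rewrite big_nil mulr1 => q0; exists [:: 1 + q]; split=> //.
  - by move=> z; rewrite inE => /eqP->; apply: nilpotent_invertible.
  - apply: (@zfree_cons_mod 0) => //; first exact: zfree_nil.
    by case=> c /addrI /eqP; rewrite mul0r (negPf q0).
  move=> z; rewrite inE => /eqP->; exists 1; by rewrite mulr1.
rewrite big_cons mulrA => qx0.
have [||//|Z [szZ uZ zZ modZ]] := IH (q * x).
- exact: nilpotentM.
- by move=> z zxs; apply: nxs; rewrite inE zxs orbT.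
exists ((1 + q) :: Z); split.
- by rewrite /= szZ.
- by move=> z; rewrite inE => /predU1P[->|/uZ//]; apply: nilpotent_invertible.
- apply: (zfree_cons_mod modZ zZ) => -[c /addrI Eq].
  case/eqP: qx0; rewrite (@nilpotent_absorb q (x * c)) ?mul0r //.
    by apply/nilpotentM/nxs/mem_head.
  by rewrite mulrA.
move=> z; rewrite inE => /predU1P[->|/modZ/one_modW//].
by exists 1; rewrite mulr1.
Qed.

End Chains.

(** * Local rings with principal maximal ideal and residue field F_2 *)

Section Uniformizer.
Variables (L : comNzRingType).
Implicit Types (x y q : L) (xs Z : seq L) (t : nat).

Definition unit_sequence Z := {in Z, forall z, invertible z} /\ zfree *%R Z.

(** The last condition says that the quotient by x has two elements. *)
Definition uniformizer x t :=
  [/\ (0 < t)%N, x ^+ t.-1 != 0, x ^+ t = 0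
    & forall b, (exists c, b = x * c) \/ one_mod x b].

Lemma uniformizer_nilpotent x t : uniformizer x t -> nilpotent_elt x.
Proof. by case=> _ _ xt _; exists t. Qed.

Lemma uniformizer_unit_or_nilpotent x t :
  uniformizer x t -> unit_or_nilpotent L.
Proof.
move=> ux b; have nx := uniformizer_nilpotent ux; have [_ _ _ dich] := ux.
have [[c ->]|[c ->]] := dich b; [right | left]; first exact: nilpotentM.
exact/nilpotent_invertible/nilpotentM.
Qed.

Lemma uniformizer_expr x t i u : uniformizer x t -> (i < t)%N ->
  invertible u -> x ^+ i * u <> 0.
Proof.
move=> [t0 /negP xt _ _] lt [v uv] E; case: xt.
rewrite (_ : t.-1 = (t.-1 - i) + i)%N; last by rewrite subnK // -ltnS prednK.
by rewrite exprD -[X in _ * X]mulr1 -uv [X in _ * X]mulrA E mul0r mulr0.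
Qed.

(** For i = 1, n = t - 1 and Z empty, this is the sequence of the 1 + x^j with
    0 < j < t, of length t - 1; the tail Z leaves room for another sequence in
    the place of the deeper terms. *)
Lemma one_modX_chain x t i n Z : uniformizer x t ->
  (0 < i)%N -> (i + n <= t)%N ->
  {in Z, forall z, one_mod (x ^+ (i + n)) z} -> unit_sequence Z ->
  let Z' := [seq 1 + x ^+ j | j <- iota i n] ++ Z in
  unit_sequence Z' /\ {in Z', forall z, one_mod (x ^+ i) z}.
Proof.
move=> ux + + + uZ; elim: n i => [|n IH] i i0.
  by rewrite addn0 => _ modZ; split.
rewrite addnS -addSn => le modZ; have [[uZ' zZ'] modZ'] := IH i.+1 isT le modZ.
have nx := uniformizer_nilpotent ux.
have lt : (i < t)%N by apply: leq_trans le; rewrite leq_addr.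
split; first split=> /=.
- move=> z; rewrite inE => /predU1P[->|/uZ'//].
  by rewrite -(prednK i0) exprS; apply/nilpotent_invertible/nilpotentM.
- apply: (zfree_cons_mod modZ' zZ') => -[c /addrI E].
  have /(uniformizer_expr ux lt) : invertible (1 + x * - c).
    exact/nilpotent_invertible/nilpotentM.
  by case; rewrite mulrDr mulr1 mulrA -exprSr mulrN -E subrr.
move=> z /=; rewrite inE => /predU1P[->|/modZ' [c ->]].
  by exists 1; rewrite mulr1.
by exists (x * c); rewrite exprSr mulrA.
Qed.

(** Three copies of g = 1 + x^k replace the two units 1 + x^k and 1 + x^(k+1) in
    the sequence of all the 1 + x^j: as g^2 has the same first term as
    1 + x^(k+1), none of g, g^2 and g^3 is 1 modulo x^(k+2).  This gains one
    element over the length t - 1. *)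
Lemma uniformizer_long_sequence x t k w : uniformizer x t ->
  (0 < k)%N -> (k.+1 < t)%N -> invertible w ->
  (1 + x ^+ k) ^+ 2 = 1 + x ^+ k.+1 * w ->
  exists2 Z, unit_sequence Z & (size Z = t)%N.
Proof.
move=> ux k0 lt uw sq; have nx := uniformizer_nilpotent ux.
have lek : (k.+2 + (t - k.+2) <= t)%N by rewrite subnKC.
have [//|//||uB modB] := one_modX_chain ux _ lek (Z := [::]).
  by split=> // ; apply: zfree_nil.
rewrite cats0 in uB modB; set B := map _ _ in uB modB.
pose C := nseq 3 (1 + x ^+ k) ++ B.
have xk : x ^+ k = x * x ^+ k.-1 by rewrite -exprS prednK.
have modC : {in C, forall z, one_mod (x ^+ k) z}.
  move=> z; rewrite mem_cat => /orP[/nseqP[-> _]|/modB].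
    by exists 1; rewrite mulr1.
  by rewrite -addn2 exprD; apply: one_modW.
have uC : unit_sequence C.
  have [uuB zB] := uB; split.
    move=> z; rewrite mem_cat => /orP[/nseqP[-> _]|/uuB//].
    by rewrite xk; apply/nilpotent_invertible/nilpotentM.
  apply: (zfree_cat (one_mod1 (x ^+ k.+2)) (@one_modM _ _)) => //.
  move=> A' z /subseq_nseqE[c le_c ->] [d ->].
  have neq e i c' : (i < t)%N -> invertible c' ->
    e = 1 -> e = 1 + x ^+ i * c' -> False.
    move=> lti uc -> /eqP; rewrite -subr_eq0 opprD addNKr oppr_eq0.
    by move/eqP; apply: uniformizer_expr ux lti uc.
  case: c le_c => [|[|[|[|//]]]] // _ /=; rewrite !big_cons big_nil mulr1 => /= E.
  - case: (@neq _ k (1 + x * (x * d + x * x ^+ k * d)) (ltnW lt) _ E).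
      exact/nilpotent_invertible/nilpotentM.
    by rewrite !exprS; ring.
  - have [v wv] := uw.
    rewrite -expr2 sq in E.
    case: (@neq _ k.+1 (w * (1 + x * ((d + x ^+ k.+1 * w * d) * v))) lt _ E).
      have [v' E'] : invertible (1 + x * ((d + x ^+ k.+1 * w * d) * v)).
        exact/nilpotent_invertible/nilpotentM.
      by exists (v * v'); rewrite mulrACA wv E' mulr1.
    rewrite [w * _]mulrDr mulr1 (_ : w * _ = w * v * (x * (d + x ^+ k.+1 * w * d))).
      by rewrite wv !exprS; ring.
    by ring.
  have {}E : (1 + x ^+ k) ^+ 2 * (1 + x ^+ k) * (1 + x ^+ k.+2 * d) = 1.
    by rewrite -[RHS]E; ring.
  rewrite sq in E.
  case: (@neq _ k (1 + x * (w + x ^+ k * w + x * d * (1 + x ^+ k)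
     * (1 + x * x ^+ k * w))) (ltnW lt) _ E).
    exact/nilpotent_invertible/nilpotentM.
  by rewrite !exprS; ring.
have [//|||//|uD _] := one_modX_chain ux (i := 1) (n := k.-1) (Z := C).
- by rewrite add1n prednK // ltnW // ltnW.
- by rewrite add1n prednK.
eexists; first exact: uD.
rewrite !size_cat !size_map !size_iota size_nseq addnA addn3 prednK //.
by rewrite subnKC.
Qed.

End Uniformizer.

(** * Isomorphisms with Z/2^t and with F_2[x]/(x^2) *)

Lemma bijective_ring_isomorphic (A L : nzRingType) (f : {rmorphism A -> L}) :
  injective f -> (forall b, exists a, f a = b) -> ring_isomorphic L A.
Proof.
move=> f_inj f_surj.
have f_surjb b : exists a, f a == b.
  by have [a <-] := f_surj b; exists a.
pose g b := xchoose (f_surjb b).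
have gK : cancel g f by move=> b; apply/eqP; exact: (xchooseP (f_surjb b)).
have fK : cancel f g by move=> a; apply: f_inj; rewrite gK.
have g_add : zmod_morphism g.
  by move=> b c; apply: f_inj; rewrite rmorphB /= !gK.
have g_mul : monoid_morphism g.
  by split=> [|b c]; apply: f_inj; rewrite ?rmorphM ?rmorph1 /= !gK.
pose gA := GRing.isZmodMorphism.Build L A g g_add.
pose gM := GRing.isMonoidMorphism.Build L A g g_mul.
pose gR : {rmorphism L -> A} := HB.pack g gA gM.
by exists gR; exists f.
Qed.

Section Cyclic.
Variables (L : comNzRingType) (n : nat).
Hypotheses (n_gt1 : (1 < n)%N)
  (charL : forall m, (m%:R == 0 :> L) = (n %| m)%N)
  (natL : forall b : L, exists m, b = m%:R).

Lemma natr_modn m : (m %% n)%N%:R = m%:R :> L.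
Proof.
have /eqP n0 : n%:R == 0 :> L by rewrite charL.
by rewrite [in RHS](divn_eq m n) natrD natrM n0 mulr0 add0r.
Qed.

Lemma cyclic_ring_isomorphic : ring_isomorphic L 'Z_n.
Proof.
pose f (a : 'Z_n) : L := (a : nat)%:R.
have f_nat m : f m%:R = m%:R by rewrite /f val_Zp_nat // natr_modn.
have f_ex a : exists m, a = m%:R :> 'Z_n by exists (a : nat); rewrite natr_Zp.
have fB : zmod_morphism f.
  have fD a b : f (a + b) = f a + f b.
    have [m ->] := f_ex a; have [k ->] := f_ex b.
    by rewrite -natrD !f_nat natrD.
  by move=> a b; apply: (addIr (f b)); rewrite -fD !subrK.
have fM : monoid_morphism f.
  split=> [|a b]; first exact: (f_nat 1%N).
  have [m ->] := f_ex a; have [k ->] := f_ex b.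
  by rewrite -natrM !f_nat natrM.
pose fA := GRing.isZmodMorphism.Build _ _ f fB.
pose fMm := GRing.isMonoidMorphism.Build _ _ f fM.
pose fR : {rmorphism 'Z_n -> L} := HB.pack f fA fMm.
apply: (@bijective_ring_isomorphic _ _ fR); last first.
  by move=> b; have [m ->] := natL b; exists m%:R; apply: f_nat.
apply: raddf_inj => a /eqP; have [m ->] := f_ex a.
rewrite -[X in X == 0]/(f m%:R) f_nat charL => /dvdnP[k ->].
by rewrite natrM pchar_Zp // mulr0.
Qed.

End Cyclic.

Section UniformizerTwo.
Variables (L : comNzRingType) (t : nat).
Hypothesis (u2 : uniformizer (2%:R : L) t).

(** If 2^j divides m and m / 2^j is odd with j < t, then m is 2^j times a unit. *)
Lemma uniformizer2_natr m : (m%:R == 0 :> L) = (2 ^ t %| m)%N.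
Proof.
have [_ _ t2 _] := u2; apply/eqP/idP => [m0|/dvdnP[k ->]]; last first.
  by rewrite natrM natrX t2 mulr0.
suff dvd j : (j <= t)%N -> (2 ^ j %| m)%N by apply: dvd.
elim: j => [|j IH] lt; first exact: dvd1n.
have /dvdnP[k def_m] := IH (ltnW lt).
rewrite def_m expnS dvdn_pmul2r ?expn_gt0 // dvdn2; apply/negP=> k_odd.
have /(uniformizer_expr u2 lt) : invertible (1 + 2%:R * k./2%:R : L).
  by apply/nilpotent_invertible/nilpotentM/uniformizer_nilpotent/u2.
case; rewrite -m0 def_m -[in RHS](odd_double_half k) k_odd natrM mulrC natrX.
by rewrite natrD -mul2n natrM.
Qed.

(** The integer m is found bit by bit. *)
Lemma uniformizer2_nat (b : L) : exists m, b = m%:R.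
Proof.
have [_ _ t2 dich] := u2.
suff [m [c ->]] : exists m c, b = m%:R + 2%:R ^+ t * c.
  by exists m; rewrite t2 mul0r addr0.
elim: t {t2} => [|j [m [c ->]]].
  by exists 0%N, b; rewrite mul1r add0r.
have [[d ->]|[d ->]] := dich c.
  by exists m, d; rewrite exprSr mulrA.
by exists (m + 2 ^ j)%N, d; rewrite natrD natrX exprSr; ring.
Qed.

Lemma uniformizer2_isomorphic : ring_isomorphic L 'Z_(2 ^ t).
Proof.
apply: cyclic_ring_isomorphic uniformizer2_natr uniformizer2_nat.
by have [t0 _ _ _] := u2; rewrite -{1}(expn0 2) ltn_exp2l.
Qed.

End UniformizerTwo.

(** The type of elements of F2_dual depends on its modulus, which hinders
    rewriting inside polynomials; all computations go through these two
    coefficients, with values in the fixed type 'F_2. *)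
Definition dual_coef (i : nat) (v : F2_dual) : 'F_2 :=
  (v : {poly %/ ('X^2 : {poly 'F_2})})`_i.
Arguments dual_coef i%_N v%_R.
Definition dual_eps : F2_dual := in_qpoly 'X^2 'X.

Lemma mk_monic_X2 : mk_monic ('X^2 : {poly 'F_2}) = 'X^2.
Proof. by rewrite mk_monic_Xn. Qed.

Lemma dual_eq v w : dual_coef 0 v = dual_coef 0 w ->
  dual_coef 1 v = dual_coef 1 w -> v = w.
Proof.
have sz2 (u : {poly %/ ('X^2 : {poly 'F_2})}) : (size u <= 2)%N.
  rewrite -ltnS; apply: leq_trans (size_mk_monic u) _.
  by rewrite mk_monic_X2 size_polyXn.
move=> e0 e1; apply/val_inj/polyP => -[|[|i]] //.
by rewrite !nth_default // (leq_trans (sz2 _)).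
Qed.

Lemma dual_coef_mod i (p : {poly 'F_2}) : (i < 2)%N ->
  dual_coef i (in_qpoly 'X^2 p) = p`_i.
Proof.
move=> i2; rewrite /dual_coef /= mk_monic_X2.
rewrite [in RHS](Pdiv.RingMonic.rdivp_eq (monicXn _ 2) p).
by rewrite coefD coefMXn i2 add0r.
Qed.

Lemma dual_coefD i v w : dual_coef i (v + w) = dual_coef i v + dual_coef i w.
Proof. exact: coefD. Qed.

Lemma dual_coef_mul i v w : (i < 2)%N ->
  dual_coef i (v * w) = \sum_(j < i.+1) dual_coef j v * dual_coef (i - j) w.
Proof.
move=> i2; pose p u : {poly 'F_2} := (u : {poly %/ ('X^2 : {poly 'F_2})}).
have -> : v * w = in_qpoly 'X^2 (p v * p w) by apply: val_inj.
by rewrite dual_coef_mod // coefM.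
Qed.

Lemma dual_coefM0 v w : dual_coef 0 (v * w) = dual_coef 0 v * dual_coef 0 w.
Proof. by rewrite dual_coef_mul // big_ord1. Qed.

Lemma dual_coefM1 v w : dual_coef 1 (v * w) =
  dual_coef 0 v * dual_coef 1 w + dual_coef 1 v * dual_coef 0 w.
Proof. by rewrite dual_coef_mul // big_ord_recl big_ord1. Qed.

Lemma dual_coef1 i : dual_coef i 1 = (i == 0%N)%:R.
Proof. by rewrite [LHS](coefC 1 i); case: i. Qed.

Lemma dual_coef0 i : dual_coef i 0 = 0.
Proof. exact: coef0. Qed.

Lemma dual_coef_eps i : (i < 2)%N -> dual_coef i dual_eps = (i == 1%N)%:R.
Proof. by move=> i2; rewrite dual_coef_mod // coefX. Qed.

Definition dual_coefE := (dual_coefD, dual_coefM0, dual_coefM1, dual_coef1,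
  dual_coef0, @dual_coef_eps 0%N isT, @dual_coef_eps 1%N isT).

Lemma F2_cases (a : 'F_2) : a = 0 \/ a = 1.
Proof. by case: a => -[|[|]] // i; [left | right]; apply: val_inj. Qed.

Lemma dual_eps2 : dual_eps ^+ 2 = 0.
Proof.
by rewrite expr2; apply: dual_eq; rewrite !dual_coefE ?mul0r ?mulr0 ?addr0.
Qed.

Lemma dual_uniformizer : uniformizer dual_eps 2.
Proof.
split=> //=; last 2 first.
- exact: dual_eps2.
- move=> b; have [b0|b0] := F2_cases (dual_coef 0 b); [left | right].
    have [b1|b1] := F2_cases (dual_coef 1 b); [exists 0 | exists 1];
    by apply: dual_eq; rewrite !dual_coefE ?b0 ?b1;
       rewrite ?(mul0r, mulr0, mulr1, addr0, add0r).
  have [b1|b1] := F2_cases (dual_coef 1 b); [exists 0 | exists 1];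
  by apply: dual_eq; rewrite !dual_coefE ?b0 ?b1;
     rewrite ?(mul0r, mulr0, mulr1, addr0, add0r).
apply/eqP => /(congr1 (dual_coef 1)).
by rewrite expr1 !dual_coefE => /eqP; rewrite oner_eq0.
Qed.

Section UniformizerDual.
Variables (L : comNzRingType) (x : L).
Hypotheses (ux : uniformizer x 2) (two0 : 2%:R = 0 :> L).

Definition F2_nat (a : 'F_2) : L := (a : nat)%:R.

Lemma F2_natD a b : F2_nat (a + b) = F2_nat a + F2_nat b.
Proof.
by have [-> | ->] := F2_cases a; have [-> | ->] := F2_cases b;
   rewrite /F2_nat /= ?addr0 ?add0r.
Qed.

Lemma F2_natM a b : F2_nat (a * b) = F2_nat a * F2_nat b.
Proof. by have [-> | ->] := F2_cases a; rewrite ?(mul0r, mul1r). Qed.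

Lemma uniformizer_dual_isomorphic : ring_isomorphic L F2_dual.
Proof.
have [_ x0 x2 dich] := ux; rewrite expr1 in x0.
pose f v := F2_nat (dual_coef 0 v) + F2_nat (dual_coef 1 v) * x.
have fD v w : f (v + w) = f v + f w.
  by rewrite /f !dual_coefE !F2_natD; ring.
have fB : zmod_morphism f.
  by move=> v w; apply: (addIr (f w)); rewrite -fD !subrK.
have fM : monoid_morphism f.
  split=> [|v w]; first by rewrite /f !dual_coefE /F2_nat /= mul0r addr0.
  rewrite /f !dual_coefE !(F2_natD, F2_natM) -[LHS]addr0.
  by rewrite -(mulr0 (F2_nat (dual_coef 1 v) * F2_nat (dual_coef 1 w))) -x2; ring.
pose fA := GRing.isZmodMorphism.Build _ _ f fB.
pose fMm := GRing.isMonoidMorphism.Build _ _ f fM.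
pose fR : {rmorphism F2_dual -> L} := HB.pack f fA fMm.
have f1 : f 1 = 1 by have [] := fM.
have f_eps : f dual_eps = x.
  by rewrite /f !dual_coefE /F2_nat /= add0r mul1r.
apply: (@bijective_ring_isomorphic _ _ fR).
  apply: raddf_inj => v fv0; have {}fv0 : f v = 0 by [].
  have [v0|v0] := F2_cases (dual_coef 0 v); last first.
    have : invertible (f v).
      rewrite /f v0 mulrC; apply/nilpotent_invertible/nilpotentM.
      exact: uniformizer_nilpotent ux.
    by move=> /(uniformizer_expr ux (ltn0Sn 1)); rewrite mul1r.
  have [v1|v1] := F2_cases (dual_coef 1 v).
    by apply: dual_eq; rewrite ?v0 ?v1 dual_coef0.
  by move: fv0; rewrite /f v0 v1 add0r mul1r => /eqP; rewrite (negPf x0).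
have xc c : exists v, f v = x * c.
  have [[d ->]|[d ->]] := dich c.
    by exists 0; rewrite mulrA -expr2 x2 mul0r; apply: (raddf0 fR).
  by exists dual_eps; rewrite f_eps mulrDr mulr1 mulrA -expr2 x2 mul0r addr0.
move=> b; have [[c ->]|[c ->]] := dich b; first exact: xc.
by have [v fv] := xc c; exists (1 + v); rewrite [LHS]fD f1 fv.
Qed.

End UniformizerDual.

(** * The four exceptional rings *)

Definition square_trivial (L : pzRingType) (x : L) :=
  forall i, (0 < i)%N -> (1 + x ^+ i) ^+ 2 = 1.

Lemma square_zero_trivial (L : comNzRingType) (x : L) :
  x ^+ 2 = 0 -> 2%:R = 0 :> L -> square_trivial x.
Proof.
move=> x2 two0 [//|i] _.
have -> : (1 + x ^+ i.+1) ^+ 2 = 1 + 2%:R * x ^+ i.+1 + x ^+ 2 * x ^+ i ^+ 2.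
  by rewrite [x ^+ i.+1]exprS; ring.
by rewrite two0 x2 !mul0r !addr0.
Qed.

Lemma dual_square_trivial : square_trivial dual_eps.
Proof.
apply: square_zero_trivial dual_eps2 _; rewrite (natrD _ 1 1).
by apply: dual_eq; rewrite !dual_coefE; apply: val_inj.
Qed.

Lemma Zp2_uniformizer t : (0 < t)%N -> uniformizer (2%:R : 'Z_(2 ^ t)) t.
Proof.
move=> t0; have n1 : (1 < 2 ^ t)%N by rewrite -{1}(expn0 2) ltn_exp2l.
split=> //.
- apply/eqP => /(congr1 (fun a : 'Z_(2 ^ t) => a : nat)).
  rewrite -natrX val_Zp_nat // modn_small.
    by apply/eqP; rewrite -lt0n expn_gt0.
  by rewrite ltn_exp2l // prednK.
- by rewrite -natrX pchar_Zp.
move=> b; rewrite -(natr_Zp b) -(odd_double_half b) -muln2 natrD natrM mulrC.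
by case: odd; [right | left]; exists ((b./2)%:R); rewrite ?add0r.
Qed.

Lemma Zp2_square_trivial t : (0 < t <= 3)%N -> square_trivial (2%:R : 'Z_(2 ^ t)).
Proof.
case/andP=> t0 t3 [//|i] _.
have h8 : 8%:R = 0 :> 'Z_(2 ^ t).
  have [_ _ xt _] := Zp2_uniformizer t0.
  by rewrite (natrX _ 2 3) -(subnK t3) exprD xt mulr0.
have sq j : (1 + 2%:R ^+ j.+1) ^+ 2 =
    1 + 8%:R * (2 ^ j.-1 * (if j is 0 then 1 else 1 + 2 ^ j))%N%:R :> 'Z_(2 ^ t).
  rewrite -natrX -(natrD _ 1) -natrX -natrM -(natrD _ 1); congr (_%:R).
  by case: j => [//|j]; rewrite !expnS; ring.
by rewrite sq h8 mul0r addr0.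
Qed.

(** * Units gained and lost in a local factor *)

Section LocalDefect.
Variable L : comNzRingType.
Implicit Types (x y q : L) (xs Z : seq L) (t d : nat).

(** Since 2 lies in the maximal ideal, it is x times a unit or a multiple of x^2.
    In the first case one can take x = 2, and L is Z/2^t; when t > 3, the square
    of 1 + 2^2 is 1 + 2^3 * 3, which gives a long sequence.  In the second case
    (1 + x)^2 = 1 + x^2 w with w a unit, which gives a long sequence when t > 2;
    L is F_2[x]/(x^2) when t = 2, and Z/2 when t = 1. *)
Lemma uniformizer_dichotomy x t : uniformizer x t ->
  [\/ ring_isomorphic L 'Z_2, ring_isomorphic L 'Z_4, ring_isomorphic L 'Z_8
    | ring_isomorphic L F2_dual] \/
  exists2 Z : seq L, unit_sequence Z & size Z = t.
Proof.
move=> ux; have nx := uniformizer_nilpotent ux.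
have [t0 /eqP xt0 xt dich] := ux.
have two_case : uniformizer (2%:R : L) t -> [\/ ring_isomorphic L 'Z_2,
    ring_isomorphic L 'Z_4, ring_isomorphic L 'Z_8 | ring_isomorphic L F2_dual] \/
    exists2 Z : seq L, unit_sequence Z & size Z = t.
  move=> u2; case: (leqP t 3) => [t3|t4].
    have := uniformizer2_isomorphic u2; move: t t0 t3 {ux xt0 xt u2}.
    by case=> [|[|[|[|//]]]] // _ _ iso; left;
       [constructor 1 | constructor 2 | constructor 3].
  right; apply: (@uniformizer_long_sequence _ _ _ 2 (1 + 2%:R) u2) => //.
    exact/nilpotent_invertible/uniformizer_nilpotent/u2.
  by ring.
have [[b two]|[b two]] := dich 2%:R; last first.
  case: (nilpotent_not_invertible nx); exists b.
  by apply: (addrI 1); rewrite -two.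
have [[c def_b]|[c def_b]] := dich b.
  move: (t) t0 xt0 xt ux two_case => [//|[|[|s]]] _ xt0 xt ux two_case.
  - apply: two_case; move: ux; rewrite two.
    by rewrite -[x]expr1 xt mul0r.
  - left; constructor 4; apply: uniformizer_dual_isomorphic ux _.
    by rewrite two def_b mulrA -expr2 xt mul0r.
  - right; apply: (@uniformizer_long_sequence _ _ _ 1 (1 + x * c) ux) => //.
      exact/nilpotent_invertible/nilpotentM.
    rewrite expr1 [LHS](_ : _ = 1 + 2%:R * x + x ^+ 2); last by ring.
    by rewrite two def_b; ring.
have [v bv] : invertible b by rewrite def_b; apply/nilpotent_invertible/nilpotentM.
apply: two_case; split=> //.
- rewrite two exprMn; apply/eqP; apply: uniformizer_expr ux _ _.
    by rewrite prednK.
  by exists (v ^+ t.-1); rewrite -exprMn bv expr1n.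
- by rewrite two exprMn xt mul0r.
move=> a; have xE e : x * e = 2%:R * (v * e).
  by rewrite two -mulrA [b * _]mulrA bv mul1r.
by have [[e ->]|[e ->]] := dich a; [left | right]; exists (v * e); rewrite xE.
Qed.

(** In the upper bound, xs is the list of the components in L of the elements of B
    that are needed in L, and y is the product of the components of the other
    elements of B; d is the number of units lost. *)
Definition local_defect d := forall y xs,
  {in xs, forall x c, y * \prod_(z <- xs) z * c <> y * \prod_(z <- rem x xs) z} ->
  exists Z : seq L, [/\ unit_sequence Z,
    {in Z, forall z, z * (y * \prod_(z <- xs) z) = y * \prod_(z <- xs) z}
    & (size xs <= size Z + d)%N].

Hypothesis unL : unit_or_nilpotent L.

Lemma needed_nilpotent y xs :
  {in xs, forall x c, y * \prod_(z <- xs) z * c <> y * \prod_(z <- rem x xs) z} ->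
  {in xs, forall x, nilpotent_elt x}.
Proof.
move=> need x xxs; have [[v xv]|//] := unL x.
case: (need x xxs v); rewrite (big_rem x) //= mulrCA -mulrA [_ * v]mulrC mulrA.
by rewrite xv mul1r.
Qed.

Lemma local_defect_nz d y xs : {in xs, forall x, nilpotent_elt x} ->
  y * \prod_(z <- xs) z != 0 ->
  exists Z : seq L, [/\ unit_sequence Z,
    {in Z, forall z, z * (y * \prod_(z <- xs) z) = y * \prod_(z <- xs) z}
    & (size xs <= size Z + d)%N].
Proof.
move=> nxs P0; have [Z [szZ uZ zZ fixZ]] := chain_stabilizers nxs P0.
by exists Z; split=> //; rewrite szZ leq_addr.
Qed.

(** If the product is 0, then the product of all elements but the first is not,
    since the first is needed; the chain of stabilizers for the others is only one
    step shorter. *)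
Lemma local_defect1 : local_defect 1.
Proof.
move=> y xs need; have nxs := needed_nilpotent need.
have [P0|/(local_defect_nz 1 nxs)//] := eqVneq (y * \prod_(z <- xs) z) 0.
case: xs => [|x xs] in need nxs P0 *.
  by exists [::]; split=> //; split=> //; apply: zfree_nil.
have /eqP Q0 : y * \prod_(z <- xs) z <> 0.
  by have := need x (mem_head _ _) 0; rewrite mulr0 /= eqxx => /nesym.
have [|Z [szZ uZ zZ _]] := chain_stabilizers _ Q0.
  by move=> z zxs; apply: nxs; rewrite inE zxs orbT.
by exists Z; split=> [//|z _|]; rewrite ?P0 ?mulr0 //= szZ addn1.
Qed.

(** Let q be y times the second element of xs, or 0 if there is none.  The chain
    of ideals that starts at (q) gives size xs - 1 units in 1 + (q).  If it cannot
    be prolonged, then every unit is in 1 + (q), so (q) is the maximal ideal; and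
    q^(size xs) = 0, since the powers of q would give a longer sequence
    otherwise. *)
Lemma long_or_uniformizer y xs : xs <> [::] ->
  {in xs, forall x, nilpotent_elt x} -> y * \prod_(z <- behead xs) z != 0 ->
  (exists2 Z : seq L, unit_sequence Z & size Z = size xs) \/
  exists x, uniformizer x (size xs).
Proof.
case: xs => [//|x0 xs] _ nxs /= Q0.
have [long|short] :=
  classic (exists2 Z : seq L, unit_sequence Z & size Z = (size xs).+1).
  by left.
right; pose q := if xs is x1 :: _ then y * x1 else 0.
have nq : nilpotent_elt q.
  rewrite /q; case: xs nxs {Q0 short q} => [|x1 xs] nxs.
    by exists 1%N; rewrite expr1.
  by rewrite mulrC; apply/nilpotentM/nxs; rewrite !inE eqxx orbT.
have [Z [szZ [uZ zZ] modZ]] : exists Z : seq L, [/\ size Z = size xs,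
    unit_sequence Z & {in Z, forall z, one_mod q z}].
  rewrite {}/q in nq *; case: xs nxs Q0 nq {short} => [|x1 xs] nxs.
    by exists [::]; split=> //; split=> //; apply: zfree_nil.
  rewrite big_cons mulrA => Q0 nq.
  have [|Z [szZ uZ zZ modZ]] := chain_ideals nq _ Q0.
    by move=> z zxs; apply: nxs; rewrite !inE zxs !orbT.
  by exists Z.
have dichU u : invertible u -> one_mod q u.
  move=> uu; have [//|nu] := classic (one_mod q u); case: short.
  exists (u :: Z); last by rewrite /= szZ.
  split; first by move=> z; rewrite inE => /predU1P[->|/uZ].
  exact: zfree_cons_mod modZ zZ nu.
have dichN b : nilpotent_elt b -> exists c, b = q * c.
  by move/nilpotent_invertible/dichU=> [c /addrI->]; exists c.
exists q; split=> //=.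
- have mulq s : {in s, forall x, nilpotent_elt x} ->
      exists c, \prod_(z <- s) z = q ^+ size s * c.
    elim: s => [|x s IH] ns; first by exists 1; rewrite big_nil mulr1.
    have [|c Ec] := IH; first by move=> z zs; apply: ns; rewrite inE zs orbT.
    have [e Ee] := dichN x (ns x (mem_head _ _)).
    by exists (e * c); rewrite big_cons Ec Ee exprS mulrACA.
  apply: contraNneq Q0; rewrite /q in mulq *.
  case: (xs) nxs mulq => [|x1 xs2] nxs mulq; first by move/eqP; rewrite oner_eq0.
  have [|c Ec] := mulq xs2.
    by move=> z zxs; apply: nxs; rewrite !inE zxs !orbT.
  by rewrite big_cons mulrA Ec mulrA -exprS => ->; rewrite mul0r.
- apply/eqP/negPn/negP => qt0; case: short.
  have [||Z' [szZ' uZ' zZ' _]] := @chain_ideals _ q (nseq (size xs) q) nq.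
  - by move=> z /nseqP[->].
  - by rewrite big_nseq iter_mulr_1 -exprS.
  by exists Z'; rewrite ?szZ' ?size_nseq.
by move=> b; have [/dichU|/dichN] := unL b; [right | left].
Qed.

Lemma local_defect0 :
  ~ [\/ ring_isomorphic L 'Z_2, ring_isomorphic L 'Z_4, ring_isomorphic L 'Z_8
      | ring_isomorphic L F2_dual] -> local_defect 0.
Proof.
move=> exc y xs need; have nxs := needed_nilpotent need.
have [P0|/(local_defect_nz 0 nxs)//] := eqVneq (y * \prod_(z <- xs) z) 0.
have [xs0|/eqP xs0] := eqVneq xs [::].
  by rewrite xs0; exists [::]; split=> //; split=> //; apply: zfree_nil.
have Q0 : y * \prod_(z <- behead xs) z != 0.
  case: xs xs0 need {nxs P0} => [//|x xs] _ need; apply/eqP.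
  by have := need x (mem_head _ _) 0; rewrite mulr0 /= eqxx => /nesym.
have [Z uZ szZ] : exists2 Z : seq L, unit_sequence Z & size Z = size xs.
  by have [//|[x /uniformizer_dichotomy[/exc|]]] := long_or_uniformizer xs0 nxs Q0.
by exists Z; split=> [//|z _|]; rewrite ?P0 ?mulr0 // szZ addn0.
Qed.

End LocalDefect.

(** * The group of units *)

Section UnitGroup.
Variable R : finComPzRingType.

Definition unit_inv (u : units R) : units R :=
  insubd u (xchoose (existsP (valP u))).

Lemma unit_mulV : left_inverse (unit_one R) unit_inv (@unit_mul R).
Proof.
move=> u; have /eqP uv := xchooseP (existsP (valP u)).
apply: val_inj; rewrite /= val_insubd ifT; first by rewrite mulrC.
by apply/existsP; exists (val u); rewrite mulrC uv.
Qed.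

HB.instance Definition _ := Finite_isGroup.Build (units R)
  (@unit_mulA R) (@unit_mul1 R) unit_mulV.

Lemma unit_groupC : @commutative (units R) (units R) mulg.
Proof. exact: unit_mulC. Qed.

Lemma zfree_unit_groupE (A : seq (units R)) :
  zfree mulg A <-> zfree *%R (map val A).
Proof.
split=> [zA _ /subseq_mapE[B sBA ->]|zA B sBA B1].
  rewrite big_map -val_unit_prod => B1; rewrite (zA B) //.
  exact: val_inj.
have /(congr1 size) : map val B = [::].
  apply: zA; first exact: map_subseq.
  by rewrite big_map -val_unit_prod; apply: (congr1 val B1).
by rewrite size_map => /size0nil.
Qed.

End UnitGroup.

(** * Products of local rings *)

Section Product.
Variables (R : finComPzRingType) (I : finType) (C : I -> comNzRingType).
Variable p : forall i, R -> C i.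
Arguments p : clear implicits.
Hypotheses (p1 : forall i, p i 1 = 1)
  (pM : forall i x y, p i (x * y) = p i x * p i y)
  (p_inj : forall x y, (forall i, p i x = p i y) -> x = y)
  (p_surj : forall f : (forall i, C i), exists x, forall i, p i x = f i).

Lemma p_prod i (T : Type) (s : seq T) (P : pred T) (F : T -> R) :
  p i (\prod_(t <- s | P t) F t) = \prod_(t <- s | P t) p i (F t).
Proof. exact: (big_morph _ (pM i) (p1 i)). Qed.

Lemma is_unitP x : reflect (forall i, invertible (p i x)) (is_unit x).
Proof.
apply: (iffP existsP) => [[y /eqP xy] i | ux].
  by exists (p i y); rewrite -pM xy p1.
have [f Ef] := fin_all_exists ux; have [y Ey] := p_surj f.
by exists y; apply/eqP/p_inj => i; rewrite pM Ey Ef p1.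
Qed.

(** The element with component z at i and 1 elsewhere: the embedding is
    multiplicative, not additive. *)
Definition embed i (z : C i) : R :=
  odflt 1 [pick r | (p i r == z) && [forall j, (j != i) ==> (p j r == 1)]].

Lemma embed_spec i (z : C i) :
  p i (embed z) = z /\ forall j, j != i -> p j (embed z) = 1.
Proof.
rewrite /embed; case: pickP => [r /andP[/eqP-> /forallP pj]|no] /=.
  by split=> // j ne; apply/eqP; move/implyP: (pj j); apply.
have [r Er] := p_surj (dfwith (fun j => 1 : C j) z).
have /negP[] := negbT (no r); rewrite Er dfwith_in eqxx /=.
by apply/forallP=> j; apply/implyP=> ne; rewrite Er dfwith_out // eq_sym.
Qed.

Lemma embedK i (z : C i) : p i (embed z) = z.
Proof. by have [] := embed_spec z. Qed.

Lemma embed_out i j (z : C i) : j != i -> p j (embed z) = 1.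
Proof. by have [_] := embed_spec z; apply. Qed.

Lemma embed_unit i (z : C i) : invertible z -> is_unit (embed z).
Proof.
move=> uz; apply/is_unitP => j; have [->|ne] := eqVneq j i; first by rewrite embedK.
by rewrite embed_out //; exists 1; rewrite mulr1.
Qed.

Definition embed_family (Z : forall i, seq (C i)) (s : seq I) : seq R :=
  flatten [seq map (@embed i) (Z i) | i <- s].

Lemma embed_familyP Z s r :
  reflect (exists i z, [/\ i \in s, z \in Z i & r = embed z])
  (r \in embed_family Z s).
Proof.
apply: (iffP flatten_mapP) => [[i si /mapP[z zZ ->]]|[i [z [si zZ ->]]]].
  by exists i, z.
by exists i => //; apply: map_f.
Qed.

Lemma embed_family_out Z s i r : i \notin s -> r \in embed_family Z s -> p i r = 1.
Proof.
move=> nis /embed_familyP[j [z [sj _ ->]]]; apply: embed_out.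
by apply: contraNneq nis => ->.
Qed.

(** The coordinates separate the contributions of the factors. *)
Lemma embed_family_zfree Z s : uniq s -> {in s, forall i, zfree *%R (Z i)} ->
  zfree *%R (embed_family Z s).
Proof.
elim: s => [_ _|i s IH /= /andP[nis us] zZ]; first exact: zfree_nil.
apply: (zfree_cat (K := fun r => p i r = 1)).
- exact: p1.
- by move=> x y px py; rewrite pM px py mulr1.
- by move=> r; apply: embed_family_out.
- by apply: IH => // j js; apply: zZ; rewrite inE js orbT.
move=> A' k /subseq_mapE[B sB ->] pk E; rewrite (zZ i _ B) ?mem_head //.
move/(congr1 (p i)): E; rewrite pM pk mulr1 p1 p_prod big_map => E.
by apply: etrans E; apply: eq_bigr => z _; rewrite embedK.
Qed.

Lemma size_embed_family Z s :
  size (embed_family Z s) = (\sum_(i <- s) size (Z i))%N.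
Proof.
rewrite size_flatten /shape sumnE !big_map.
by apply: eq_bigr => i _; rewrite size_map.
Qed.

Section Upper.
Variable d : I -> nat.
Hypotheses (unC : forall i, unit_or_nilpotent (C i))
  (defC : forall i, local_defect (C i) (d i)).

(** In a factor where x is not a unit, the component of P absorbs a nilpotent
    element, so it is 0 and the component of u can be 1. *)
Lemma associate_unit (P x : R) : (exists e, P * x * e = P) ->
  exists2 u, is_unit u & P * u = P * x.
Proof.
case=> e PE.
have ex i : exists v : C i, invertible v /\ p i P * v = p i P * p i x.
  have [ux|nx] := unC (p i x); first by exists (p i x).
  exists 1; split; first by exists 1; rewrite mulr1.
  rewrite (nilpotent_absorb (nilpotentM (p i e) nx) (q := p i P)) ?mul0r //.
  by rewrite -!pM mulrA PE.
have [v Ev] := fin_all_exists ex; have [u Eu] := p_surj v.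
exists u; first by apply/is_unitP => i; rewrite Eu; case: (Ev i).
by apply: p_inj => i; rewrite !pM Eu; case: (Ev i).
Qed.

(** B is a minimal set of positions whose product P is associate to the product of
    A.  The units of W1 replace the elements of A outside B, and those of W2
    replace the elements at the positions in B.  The latter fix P, which gives the
    submonoid needed to put W1 and W2 together. *)
Lemma irreducible_size_leq (A : seq R) : ~~ reducible *%R A ->
  (size A < davenport_units R + \sum_i d i)%N.
Proof.
move=> irrA; pose k := size A; pose a (j : 'I_k) := nth 1 A j.
have defA : A = map a (enum 'I_k).
  apply: (@eq_from_nth _ 1); first by rewrite size_map size_enum_ord.
  move=> j ltj; rewrite (nth_map (Ordinal ltj)) ?size_enum_ord //.
  by rewrite /a nth_enum_ord.
pose prod (T : {set 'I_k}) := \prod_(j in T) a j.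
have irr T : prod T = prod setT -> T = setT.
  move=> eqp; apply/eqP; rewrite eqEcard subsetT /= cardsT card_ord.
  suff: size (map a (enum T)) = size A by rewrite size_map -cardE => ->.
  apply: (irreducible_size irrA).
    rewrite defA; apply: map_subseq; rewrite [X in subseq _ X]enumT.
    exact: filter_subseq.
  rewrite /seq_prod [in RHS]defA !big_map /= !big_enum /=.
  by rewrite -[LHS]/(prod T) eqp /prod; apply: eq_bigl => j; rewrite inE.
pose full (T : {set 'I_k}) := [exists c, prod setT * c == prod T].
have full_setT : full setT by apply/existsP; exists 1; rewrite mulr1.
have [B /minsetP[/existsP[c0 /eqP Bc0] minB] _] := minset_exists full_setT.
set P := prod B in Bc0.
have prodC : prod setT = P * prod (~: B).
  by rewrite /prod (big_setID B) /= setTI setTD.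
have unit_of j : exists u, j \notin B -> is_unit u /\ P * u = P * a j.
  have [jB|jB] := boolP (j \in B); first by exists 1.
  have [|u uu Pu] := @associate_unit P (a j); last by exists u.
  exists (prod (~: B :\ j) * c0).
  rewrite mulrA -[P * _ * _]mulrA (_ : a j * _ = prod (~: B)) -?prodC //.
  by rewrite /prod [RHS](big_setD1 j) // inE.
have [u uP] := fin_all_exists unit_of.
(* N i is the set of positions of B that are needed in the factor i.  The
   witness c is taken in R since [p i] is onto, which makes the condition
   decidable. *)
pose N i := [set j in B | ~~ [exists c, p i (P * c) == p i (prod (B :\ j))]].
have coverB : B \subset \bigcup_i N i.
  apply/subsetP=> j jB.
  have [/existsP[i jN]|/existsPn none] := boolP [exists i, j \in N i].
    by apply/bigcupP; exists i.
  have ex i : exists c, p i (P * c) == p i (prod (B :\ j)).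
    by apply/existsP; have := none i; rewrite inE jB /= negbK.
  have [c Ec] := fin_all_exists ex; have [c' Ec'] := p_surj (fun i => p i (c i)).
  have fullj : full (B :\ j).
    apply/existsP; exists (c0 * c'); rewrite mulrA Bc0; apply/eqP/p_inj => i.
    by rewrite pM Ec' -pM; apply/eqP.
  have := minB _ fullj (subsetDl _ _) => /setP/(_ j).
  by rewrite !inE eqxx jB.
have exZ i : exists Z : seq (C i), [/\ unit_sequence Z,
    {in Z, forall z, z * p i P = p i P} & (#|N i| <= size Z + d i)%N].
  have subN : N i \subset B by apply/subsetP=> j; rewrite inE => /andP[].
  pose y := p i (prod (B :\: N i)); pose xs := [seq p i (a j) | j <- enum (N i)].
  have Py : y * \prod_(z <- xs) z = p i P.
    rewrite big_map big_enum /= /y -p_prod -pM; congr (p i _).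
    by rewrite /P /prod (big_setID (N i) (A := B)) /= (setIidPr subN) mulrC.
  have [|Z [uZ fixZ szZ]] := @defC i y xs.
    move=> x /mapP[j]; rewrite mem_enum => jN ->; rewrite Py => c E.
    have [cr Ec] := p_surj (dfwith (fun i => 1 : C i) c).
    have := jN; rewrite inE => /andP[jB /existsP[]]; exists cr.
    have perm_rem : perm_eq (rem (p i (a j)) xs)
        [seq p i (a l) | l <- enum (N i :\ j)].
      have jE : j \in enum (N i) by rewrite mem_enum.
      rewrite -(perm_cons (p i (a j))) -(permPl (perm_to_rem (map_f _ jE))).
      rewrite (permPl (perm_map _ (perm_to_rem jE))) perm_cons perm_map //.
      apply: uniq_perm; rewrite ?rem_uniq ?enum_uniq // => l.
      by rewrite mem_rem_uniq ?enum_uniq // !(inE, mem_enum).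
    rewrite pM Ec dfwith_in E (perm_big _ perm_rem) big_map big_enum /= -p_prod -pM.
    apply/eqP; congr (p i _).
    rewrite /prod [RHS](big_setID (N i)) /= mulrC; congr (_ * _).
      apply: eq_bigl => l.
      by rewrite !inE; case: (l != j); rewrite ?andbF ?andbA ?andbb.
    apply: eq_bigl => l; rewrite in_setD [RHS]in_setD in_setD1.
    by case: eqP => [->|_]; rewrite ?jN.
  by exists Z; rewrite -Py; split=> //; move: szZ; rewrite size_map -cardE.
have [Z ZP] := fin_all_exists exZ.
pose W1 := map u (enum (~: B)); pose W2 := embed_family Z (enum I).
have unitW : all (@is_unit R) (W1 ++ W2).
  rewrite all_cat; apply/andP; split; apply/allP=> r.
    move=> /mapP[j]; rewrite mem_enum inE => jB ->; by case: (uP j jB).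
  move=> /embed_familyP[i [z [_ zZ ->]]]; apply: embed_unit.
  by case: (ZP i) => -[uZ _] _ _; apply: uZ.
have zfreeW : zfree *%R (W1 ++ W2).
  apply: (zfree_cat (K := fun r => P * r = P)).
  - exact: mulr1.
  - by move=> r s Pr Ps; rewrite mulrA Pr Ps.
  - move=> r /embed_familyP[i [z [_ zZ ->]]]; apply: p_inj => j; rewrite pM.
    have [->|ne] := eqVneq j i; last by rewrite embed_out // mulr1.
    by rewrite embedK mulrC; case: (ZP i) => _ fixZ _; apply: fixZ.
  - apply: embed_family_zfree; first exact: enum_uniq.
    by move=> i _; case: (ZP i) => -[].
  move=> A' r /subseq_mapE[s sub_s ->] Pr E.
  have sB : {in s, forall j, j \notin B}.
    by move=> j /(mem_subseq sub_s); rewrite mem_enum inE.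
  (* So the elements of A at the positions in s can be dropped. *)
  have Ps : P * \prod_(j <- s) a j = P.
    have -> : P * \prod_(j <- s) a j = P * \prod_(j <- map u s) j.
      elim: s sB {sub_s E} => [|j s IH] sB; rewrite ?big_nil // big_cons /= big_cons.
      have [_ Puj] := uP j (sB j (mem_head _ _)).
      rewrite mulrA mulrAC IH => [|l ls]; last by apply: sB; rewrite inE ls orbT.
      by rewrite mulrAC -Puj mulrA.
    by rewrite -[in LHS]Pr -mulrA [r * _]mulrC E mulr1.
  pose T := [set j in s].
  have prT : \prod_(j <- s) a j = prod T.
    rewrite big_uniq /= ?(subseq_uniq sub_s) ?enum_uniq //.
    by apply: eq_bigl => j; rewrite inE.
  have /irr : prod (~: T) = prod setT.
    have sTB : T \subset ~: B by apply/subsetP=> j; rewrite !inE => /sB.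
    rewrite prodC /prod (big_setID T (A := ~: B)) /= (setIidPr sTB).
    rewrite -/(prod T) -prT mulrA Ps (big_setID B) /=.
    congr (_ * _); apply: eq_bigl => j; last by rewrite !inE andbC.
    rewrite !inE andbC; case jB: (j \in B) => //=; apply/negP=> /sB.
    by rewrite jB.
  move/setP=> Tfull; case def_s: s => [//|j s'].
  by have := Tfull j; rewrite !inE def_s mem_head.
have := zfree_units_ltn unitW zfreeW.
rewrite size_cat size_map -cardE size_embed_family big_enum /= => lt.
have leB : (#|B| <= \sum_i (size (Z i) + d i))%N.
  apply: leq_trans (subset_leq_card coverB) _.
  apply: leq_trans (_ : \sum_i #|N i| <= _)%N; last first.
    by apply: leq_sum => i _; case: (ZP i).
  elim/big_rec2: _ => [|i m S _ le]; first by rewrite cards0.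
  by apply: leq_trans (leq_card_setU _ _) _; rewrite leq_add2l.
rewrite (_ : size A = #|~: B| + #|B|)%N; last first.
  by rewrite addnC cardsC card_ord.
rewrite big_split /= in leB.
apply: leq_ltn_trans (leq_add (leqnn _) leB) _.
by rewrite addnA ltn_add2r.
Qed.

Theorem davenport_ring_leq :
  (davenport_ring R <= davenport_units R + \sum_i d i)%N.
Proof.
have [A irrA szA] := irreducible_max (@GRing.mul R : Monoid.com_law 1).
by rewrite /davenport_ring -szA; apply: irreducible_size_leq.
Qed.

End Upper.

Section Lower.
Variables (x : forall i, C i) (r : I -> nat).

(** The total product is 0 in each factor of s, whereas keeping fewer than r i
    copies of x i leaves a nonzero component; so all copies are kept, and the
    units can be compared separately. *)
Lemma irreducible_powers (s : seq I) (U : seq R) : uniq s ->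
  {in s, forall i, (0 < r i)%N /\ x i ^+ (r i).-1 != 0 /\ x i ^+ r i = 0} ->
  all (@is_unit R) U -> zfree *%R U ->
  {in U, forall u, {in s, forall i, p i u = 1}} ->
  ~~ reducible *%R (embed_family (fun i => nseq (r i) (x i)) s ++ U).
Proof.
move=> us rs uU zU U1; apply: irreducibleP.
elim: s us rs U1 => [_ _ _|i s IH /= /andP[nis us] rs U1] B.
  rewrite /= => sBU eqp.
  have [D [sDU szD prD]] := subseq_complement (@GRing.mul R : Monoid.com_law 1) sBU.
  have /existsP[y /eqP By] : is_unit (\prod_(b <- B) b).
    rewrite big_seq; apply: (big_ind (@is_unit R)); first exact: is_unit1.
      exact: is_unitM.
    by move=> b bB; apply: (allP uU); apply: mem_subseq bB.
  suff D0 : D = [::] by rewrite -szD D0 addn0.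
  have cancelB z : (\prod_(b <- B) b) * z = \prod_(b <- B) b -> z = 1.
    by move=> Bz; rewrite -[z]mul1r -By mulrAC Bz.
  by apply: zU sDU _; apply: cancelB; apply: etrans prD (esym eqp).
rewrite /embed_family /= -catA -/(embed_family _ s); set A := _ ++ U.
case/subseq_catE=> _ [B2 [-> /subseq_mapE[B1 /subseq_nseqE[c le_c ->] ->] sB2A]].
rewrite /seq_prod !big_cat /= !map_nseq !big_nseq !iter_mulr_1 => E.
have {E} eqp : embed (x i) ^+ c * \prod_(b <- B2) b
  = embed (x i) ^+ r i * \prod_(a <- A) a
  by rewrite [in RHS]big_cat; exact: E.
have [r0 [xr0 xr]] := rs i (mem_head _ _).
have pA : {in A, forall a, p i a = 1}.
  move=> a; rewrite mem_cat => /orP[/(embed_family_out nis)//|/U1]; apply.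
  exact: mem_head.
have pX n j : p j (embed (x i) ^+ n) = p j (embed (x i)) ^+ n.
  by elim: n => [|n IHn]; rewrite ?p1 // !exprS pM IHn.
have p_one D : {in D, forall a, p i a = 1} -> p i (\prod_(a <- D) a) = 1.
  move=> D1; rewrite p_prod big_seq big1 // => a; exact: D1.
have B2i := p_one B2 (fun a aB => pA a (mem_subseq sB2A aB)).
have def_c : c = r i.
  apply/eqP; rewrite eqn_leq le_c leqNgt; apply: contra xr0 => ltc.
  have := congr1 (p i) eqp; rewrite !pM B2i (p_one A pA) !pX embedK xr !mulr1 => xc.
  by rewrite -(subnK (_ : c <= (r i).-1)%N) ?exprD ?xc ?mulr0 // -ltnS prednK.
rewrite size_cat [RHS]size_cat !size_nseq def_c; congr (_ + _)%N.
apply: IH => //.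
- by move=> j js; apply: rs; rewrite inE js orbT.
- by move=> u uU' j js; apply: U1; rewrite // inE js orbT.
apply: p_inj => j; have [->|ne] := eqVneq j i.
  by rewrite [LHS]B2i [RHS](p_one A pA).
by have := congr1 (p j) eqp; rewrite !pM !pX embed_out // !expr1n !mul1r.
Qed.

Lemma davenport_ring_gt (s : seq I) (U : seq R) : uniq s ->
  {in s, forall i, (0 < r i)%N /\ x i ^+ (r i).-1 != 0 /\ x i ^+ r i = 0} ->
  all (@is_unit R) U -> zfree *%R U ->
  {in U, forall u, {in s, forall i, p i u = 1}} ->
  (\sum_(i <- s) r i + size U < davenport_ring R)%N.
Proof.
move=> us rs uU zU U1.
have := irreducible_ltn (irreducible_powers us rs uU zU U1).
rewrite size_cat size_embed_family; congr (_ + _ < _)%N.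
by apply: eq_bigr => i _; rewrite size_nseq.
Qed.

Section TwoGroup.
Variable s : seq I.
Hypotheses (us : uniq s) (card2 : exists m, #|{: units R}| = (2 ^ m)%N).
Hypothesis ux : {in s, forall i, uniformizer (x i) (r i) /\ square_trivial (x i)}.

Let uval (u : units R) : R := val u.
Definition embed_units i (z : C i) : units R := insubd (unit_one R) (embed z).

Lemma val_embed_units i (z : C i) : invertible z ->
  val (embed_units z) = embed z.
Proof. by move=> uz; rewrite val_insubd embed_unit. Qed.

Definition trivial_at : {set units R} :=
  [set u | all (fun i => p i (uval u) == 1) s].

Lemma trivial_at_group_set : group_set trivial_at.
Proof.
apply/group_setP; split; first by rewrite inE; apply/allP=> i _; rewrite /uval /= p1.
move=> u v; rewrite !inE => /allP pu /allP pv; apply/allP=> i si.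
by rewrite /uval /= pM (eqP (pu i si)) (eqP (pv i si)) mulr1.
Qed.
Canonical trivial_at_group := Group trivial_at_group_set.

Lemma embed_units_sq i j : i \in s -> (0 < j)%N ->
  (embed_units (1 + x i ^+ j) * embed_units (1 + x i ^+ j) = 1)%g.
Proof.
move=> si j0; have [uxi sqi] := ux si; have nx := uniformizer_nilpotent uxi.
have uy : invertible (1 + x i ^+ j).
  by rewrite -(prednK j0) exprS; apply/nilpotent_invertible/nilpotentM.
apply/val_inj/p_inj => k; rewrite /= val_embed_units // pM p1.
have [->|ne] := eqVneq k i; last by rewrite embed_out // mulr1.
by rewrite embedK -expr2 sqi.
Qed.

Definition involutions (s' : seq I) : seq (units R) :=
  flatten [seq [seq embed_units (1 + x i ^+ j) | j <- iota 1 (r i).-1] | i <- s'].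

(** In a factor i of s', a unit 1 + x^j c has c in the maximal ideal or c in
    1 + (x); in the second case multiplying by 1 + x^j raises j, as this element
    is its own inverse. *)
Lemma involutions_spanned s' gs : {subset s' <= s} ->
  {in trivial_at, forall u, spanned gs u} ->
  forall u, {in s, forall i, i \notin s' -> p i (uval u) = 1} ->
  spanned (involutions s' ++ gs) u.
Proof.
move=> + sp; elim: s' => [|i s' IH] sub u pu /=.
  by apply: sp; rewrite inE; apply/allP=> i si; apply/eqP; apply: pu.
have si : i \in s by apply: sub; rewrite mem_head.
have {}sub : {subset s' <= s} by move=> j js; apply: sub; rewrite inE js orbT.
have {}IH := IH sub.
have [uxi sqi] := ux si; have nx := uniformizer_nilpotent uxi.
have [r0 _ xr dich] := uxi.
rewrite /involutions /= -catA -/(involutions s').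
have [c pc] : one_mod (x i) (p i (uval u)).
  have [[c pc]|//] := dich (p i (uval u)).
  have /is_unitP/(_ i) : is_unit (uval u) := valP u.
  by rewrite pc => /nilpotent_not_invertible[]; apply: nilpotentM.
have mod1 : one_mod (x i ^+ 1) (p i (uval u)) by exists c; rewrite expr1.
suff gen n j w : {in s, forall k, k \notin i :: s' -> p k (uval w) = 1} ->
    one_mod (x i ^+ j) (p i (uval w)) -> (0 < j)%N -> (j + n)%N = r i ->
    spanned ([seq embed_units (1 + x i ^+ l) | l <- iota j n]
      ++ involutions s' ++ gs) w.
  by apply: gen => //; rewrite add1n prednK.
elim: n j w {u pu c pc mod1} => [|n IHn] j u pu modj j0.
  rewrite addn0 => jr; apply: IH => k ks nk.
  have [->|ne] := eqVneq k i; last by apply: pu => //; rewrite inE negb_or ne.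
  by case: modj => c; rewrite jr xr mul0r addr0.
rewrite addnS -addSn => jr.
case: modj => c pc; have [[c' def_c]|[c' def_c]] := dich c.
  exists 0%N, u; rewrite expg0 mul1g; split=> //; apply: IHn => //.
  by exists c'; rewrite pc def_c mulrA -exprSr.
pose y := embed_units (1 + x i ^+ j).
have uy : invertible (1 + x i ^+ j).
  by rewrite -(prednK j0) exprS; apply/nilpotent_invertible/nilpotentM.
exists 1%N, (y * u)%g; rewrite expg1 mulgA embed_units_sq // mul1g; split=> //.
apply: IHn => //.
  move=> k ks nk; rewrite /uval /= pM val_embed_units // embed_out ?mul1r.
    exact: pu.
  by apply: contraNneq nk => ->; rewrite mem_head.
rewrite /uval /= pM val_embed_units // embedK -/(uval u) pc def_c.
exists (c' * (1 + x i ^+ j)).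
by rewrite -[X in _ = X + _](sqi j j0) [x i ^+ j.+1]exprSr; ring.
Qed.

Theorem davenport_ring_two_group :
  (davenport_units R + size s <= davenport_ring R)%N.
Proof.
have abH : abelian trivial_at_group.
  by apply/centsP=> u _ v _; apply: unit_groupC.
have [gs [sgs spgs [A [sA zA szA]]]] := basis_zfree abH.
have pow2 (u : units R) : exists e, #[u]%g = (2 ^ e)%N.
  have [m card_m] := card2; have : (#[u]%g %| 2 ^ m)%N.
    by rewrite -card_m -cardsT; apply: order_dvdG; rewrite inE.
  by case/(dvdn_pfactor _ _ (isT : prime 2)) => e _ ->; exists e.
have [M irrM szM] := irreducible_max (@unit_mul R).
have zM : zfree mulg M by apply/zfree_unit_groupE/zfree_unitsE.
have leM : (size M <= \sum_(y <- involutions s ++ gs) (#[y]%g).-1)%N.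
  apply: (zfree_leq (@unit_groupC R)) zM => // u _.
  by apply: involutions_spanned => // i -> .
have leI : (\sum_(y <- involutions s) (#[y]%g).-1 + size s <= \sum_(i <- s) r i)%N.
  rewrite big_flatten big_map -sum1_size -big_split /=.
  rewrite big_seq [X in (_ <= X)%N]big_seq.
  apply: leq_sum => i si; have [uxi sqi] := ux si; have [r0 _ _ _] := uxi.
  rewrite -(prednK r0) addn1 ltnS big_map -[X in (_ <= X)%N](size_iota 1) -sum1_size.
  rewrite big_seq [X in (_ <= X)%N]big_seq; apply: leq_sum => j.
  rewrite mem_iota => /andP[j0 _].
  rewrite -ltnS prednK ?order_gt0 //; apply: dvdn_leq => //; rewrite order_dvdn.
  by rewrite expgS expg1 embed_units_sq.
have := @davenport_ring_gt s (map val A) us.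
rewrite size_map szA /davenport_units -szM => gtD.
apply: leq_trans (gtD _ _ _ _) => {gtD}.
- rewrite addSn ltnS; apply: leq_trans (leq_add leM (leqnn _)) _.
  by rewrite big_cat /= addnAC leq_add2r.
- by move=> i si; have [[]] := ux si.
- by apply/allP=> _ /mapP[u _ ->]; apply: valP.
- exact/zfree_unit_groupE.
move=> w /mapP[u /sA uH ->] i si.
by move: uH; rewrite inE => /allP/(_ i si)/eqP.
Qed.

End TwoGroup.
End Lower.
End Product.

(** * The decomposition of the ring *)

Section Components.
Variables (k1 k2 k3 k4 n : nat) (L : 'I_n -> finComNzRingType).

Definition factor_index : finType := ('I_k1 + 'I_k2 + 'I_k3 + 'I_k4 + 'I_n)%type.

Definition factor (i : factor_index) : comNzRingType :=
  match i with
  | inl (inl (inl (inl _))) => 'Z_2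
  | inl (inl (inl (inr _))) => 'Z_4
  | inl (inl (inr _)) => 'Z_8
  | inl (inr _) => F2_dual
  | inr j => L j
  end.

Local Notation product := ({ffun 'I_k1 -> 'Z_2} * {ffun 'I_k2 -> 'Z_4} *
  {ffun 'I_k3 -> 'Z_8} * {ffun 'I_k4 -> F2_dual} * dprod_ring L)%type.

Definition coordinate (i : factor_index) (v : product) : factor i :=
  match i with
  | inl (inl (inl (inl j))) => v.1.1.1.1 j
  | inl (inl (inl (inr j))) => v.1.1.1.2 j
  | inl (inl (inr j)) => v.1.1.2 j
  | inl (inr j) => v.1.2 j
  | inr j => (v.2 : {dffun forall i, L i}) j
  end.

Lemma coordinate1 i : coordinate i 1 = 1.
Proof. by case: i => [[[[j|j]|j]|j]|j]; rewrite /= ffunE. Qed.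

Lemma coordinateM i v w : coordinate i (v * w) = coordinate i v * coordinate i w.
Proof. by case: i => [[[[j|j]|j]|j]|j]; rewrite /= ffunE. Qed.

Lemma coordinate_inj v w : (forall i, coordinate i v = coordinate i w) -> v = w.
Proof.
case: v w => [[[[v1 v2] v3] v4] v5] [[[[w1 w2] w3] w4] w5] eq_vw.
congr (_, _, _, _, _); apply/ffunP => j.
- exact: (eq_vw (inl (inl (inl (inl j))))).
- exact: (eq_vw (inl (inl (inl (inr j))))).
- exact: (eq_vw (inl (inl (inr j)))).
- exact: (eq_vw (inl (inr j))).
exact: (eq_vw (inr j)).
Qed.

Lemma coordinate_surj (f : forall i, factor i) :
  exists v, forall i, coordinate i v = f i.
Proof.
exists ([ffun j => f (inl (inl (inl (inl j)))) : 'Z_2],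
        [ffun j => f (inl (inl (inl (inr j)))) : 'Z_4],
        [ffun j => f (inl (inl (inr j))) : 'Z_8],
        [ffun j => f (inl (inr j)) : F2_dual],
        [ffun j => f (inr j) : L j] : dprod_ring L).
by case=> [[[[j|j]|j]|j]|j]; rewrite /= ffunE.
Qed.

Definition factor_unif (i : factor_index) : factor i :=
  match i with
  | inl (inl (inl (inl _))) => 2%:R : 'Z_2
  | inl (inl (inl (inr _))) => 2%:R : 'Z_4
  | inl (inl (inr _)) => 2%:R : 'Z_8
  | inl (inr _) => dual_eps
  | inr j => 0
  end.

Definition factor_length (i : factor_index) : nat :=
  match i with
  | inl (inl (inl (inl _))) => 1
  | inl (inl (inl (inr _))) => 2
  | inl (inl (inr _)) => 3
  | inl (inr _) => 2
  | inr j => 0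
  end.

Lemma factor_uniformizer i :
  uniformizer (factor_unif (inl i)) (factor_length (inl i)) /\
  square_trivial (factor_unif (inl i)).
Proof.
case: i => [[[j|j]|j]|j] /=.
- exact: (conj (@Zp2_uniformizer 1 isT) (@Zp2_square_trivial 1 isT)).
- exact: (conj (@Zp2_uniformizer 2 isT) (@Zp2_square_trivial 2 isT)).
- exact: (conj (@Zp2_uniformizer 3 isT) (@Zp2_square_trivial 3 isT)).
exact: (conj dual_uniformizer dual_square_trivial).
Qed.

Definition factor_defect (i : factor_index) : nat := if i is inl _ then 1 else 0.

Lemma sum_factor_defect : (\sum_i factor_defect i = k1 + k2 + k3 + k4)%N.
Proof.
by rewrite !big_sumType /= !sum_nat_const !card_ord !muln1 muln0 addn0.
Qed.

End Components.

Theorem corollary3p1 (k1 k2 k3 k4 n : nat) (L : 'I_n -> finComNzRingType)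
    (R : finComPzRingType)
    (L_local : forall i, local_ring (L i))
    (L_excluded : forall i,
       [/\ ~ ring_isomorphic (L i) 'Z_2, ~ ring_isomorphic (L i) 'Z_4,
           ~ ring_isomorphic (L i) 'Z_8 & ~ ring_isomorphic (L i) F2_dual])
    (R_form : ring_isomorphic R
       ({ffun 'I_k1 -> 'Z_2} * {ffun 'I_k2 -> 'Z_4} * {ffun 'I_k3 -> 'Z_8} *
        {ffun 'I_k4 -> F2_dual} * dprod_ring L)%type) :
  (davenport_units R + k1 <= davenport_ring R
     <= davenport_units R + k1 + k2 + k3 + k4)%N /\
  ((exists m, #|{: units R}| = 2 ^ m)%N \/ [/\ k2 = 0, k3 = 0 & k4 = 0]%N ->
   davenport_ring R = davenport_units R + k1 + k2 + k3 + k4)%N.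
Proof.
have [f [g fK gK]] := R_form.
pose p i (a : R) := coordinate i (f a).
have p1 i : p i 1 = 1 by rewrite /p rmorph1 coordinate1.
have pM i a b : p i (a * b) = p i a * p i b by rewrite /p rmorphM coordinateM.
have p_inj a b : (forall i, p i a = p i b) -> a = b.
  by move=> eq_ab; apply: (can_inj fK); apply: coordinate_inj.
have p_surj (h : forall i, factor L i) : exists a, forall i, p i a = h i.
  by have [v Ev] := coordinate_surj h; exists (g v) => i; rewrite /p gK.
have unC (i : factor_index k1 k2 k3 k4 n) : unit_or_nilpotent (factor L i).
  case: i => [i|i]; last exact: local_unit_or_nilpotent.
  by have [/uniformizer_unit_or_nilpotent] := factor_uniformizer L i.
have defC (i : factor_index k1 k2 k3 k4 n) : local_defect (factor L i) (factor_defect i).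
  case: i => i; first exact: (local_defect1 (unC (inl i))).
  apply: local_defect0; first exact: (unC (inr i)).
  by have [? ? ? ?] := L_excluded i; case.
have upper := davenport_ring_leq p1 pM p_inj p_surj unC defC.
rewrite sum_factor_defect !addnA in upper.
have lower : (davenport_units R + k1 <= davenport_ring R)%N.
  have [U [uU zU szU]] := zfree_units_max R.
  pose s : seq (factor_index k1 k2 k3 k4 n) :=
    [seq inl (inl (inl (inl j))) | j <- enum 'I_k1].
  have us : uniq s by rewrite map_inj_uniq ?enum_uniq // => i j [].
  have lt : (\sum_(i <- s) factor_length i + size U < davenport_ring R)%N.
    apply: (davenport_ring_gt p1 pM p_inj p_surj (x := factor_unif L)) => //.
      move=> _ /mapP[j _ ->].
      by have [[]] := @factor_uniformizer k1 k2 k3 k4 n L (inl (inl (inl j))).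
    move=> u /(allP uU)/(is_unitP p1 pM p_inj p_surj) uu _ /mapP[j _ ->].
    have [p0|//] := F2_cases (p (inl (inl (inl (inl j)))) u).
    case: (nilpotent_not_invertible _ (uu (inl (inl (inl (inl j)))))).
    by exists 1%N; rewrite expr1 p0.
  by move: lt; rewrite big_map sum1_size size_enum_ord -szU addSn addnC.
split; first by rewrite lower.
case=> [card2|[k20 k30 k40]]; last first.
  apply/eqP; rewrite eqn_leq upper; move: lower.
  by rewrite k20 k30 k40 !addn0.
apply/eqP; rewrite eqn_leq upper.
pose s : seq (factor_index k1 k2 k3 k4 n) :=
  [seq inl i | i <- enum {: 'I_k1 + 'I_k2 + 'I_k3 + 'I_k4}].
have us : uniq s by rewrite map_inj_uniq ?enum_uniq // => i j [].
have := davenport_ring_two_group p1 pM p_inj p_surj (x := factor_unif L)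
  (r := @factor_length k1 k2 k3 k4 n) us card2.
rewrite size_map -cardE !card_sum !card_ord !addnA; apply.
by move=> _ /mapP[i _ ->]; apply: factor_uniformizer.
Qed.
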